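(* For every positive integer $n$, we have $$\zeta^{*}(\underbrace{3,1,\ldots,3,1}_{2n})=\sum_{i=0}^{n}\left\{\frac{2}{(4i+2)!}\sum_{\substack{n_{0}+n_{1}=2(n-i)\\ n_{0},n_{1}\geq 0}}(-1)^{n_{1}}\frac{(2^{2n_{0}}-2)B_{2n_{0}}}{(2n_{0})!}\,\frac{(2^{2n_{1}}-2)B_{2n_{1}}}{(2n_{1})!}\right\}\pi^{4n},$$ where the inner sum runs over pairs of nonnegative integers $(n_0,n_1)$ with $n_0+n_1=2(n-i)$. In particular, $\zeta^{*}(\underbrace{3,1,\ldots,3,1}_{2n})$ is a rational multiple of $\pi^{4n}$.
   Context: For positive integers $k_1,\ldots,k_r$ with $k_1\geq 2$, the multiple zeta-star value is the convergent series $$\zeta^*(k_1,\ldots,k_r)=\sum_{m_1\geq m_2\geq\cdots\geq m_r>0}\frac{1}{m_1^{k_1}m_2^{k_2}\cdots m_r^{k_r}},$$ the sum being over positive integers $m_1,\dots,m_r$. The notation $\underbrace{3,1,\ldots,3,1}_{2n}$ denotes the sequence of length $2n$ in which the block $3,1$ is repeated $n$ times. $B_{2j}$ ($j\ge 0$) denotes the classical Bernoulli numbers, defined by $\frac{t}{e^t-1}=\sum_{j\ge0}B_j\frac{t^j}{j!}$ (so $B_0=1$, $B_2=1/6$, $B_4=-1/30$). *)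

(* Defs.v *)
From HB Require Import structures.
From mathcomp Require Import all_boot all_order all_algebra.
From mathcomp Require Import all_classical all_reals all_analysis.
Set Implicit Arguments.
Unset Strict Implicit.
Unset Printing Implicit Defensive.
Import Order.TTheory GRing.Theory Num.Theory.
Import numFieldNormedType.Exports.
Local Open Scope classical_set_scope.
Local Open Scope ring_scope.

(* The sum is valued in [\bar R], so that an equation [zeta_star R k = x%:E]
   also asserts that the series converges. *)
Definition zeta_star (R : realType) (k : seq nat) : \bar R :=
  \esum_(m in [set m : (size k).-tuple nat | sorted geq m && all (ltn 0%N) m])
    (\prod_(i < size k) ((tnth m i)%:R ^+ nth 0%N k i)^-1)%:E.

(* The generating identity is an identity of functions on a punctured
   neighbourhood of 0, the quotient t / (e^t - 1) being 0 / 0 at t = 0.  It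
   determines B uniquely. *)
Definition bernoulli (R : realType) : nat -> R :=
  get [set B : nat -> R | \forall t \near (0 : R)^',
    pseries (fun j => B j / j`!%:R) t @ \oo --> t / (expR t - 1)].

(* Main.v *)
Require Import Defs.
From HB Require Import structures.
From mathcomp Require Import all_boot all_order all_algebra.
From mathcomp Require Import all_classical all_reals all_analysis.
From mathcomp Require Import ring lra zify.
Set Implicit Arguments.
Unset Strict Implicit.
Unset Printing Implicit Defensive.
Import Order.TTheory GRing.Theory Num.Theory.
Import numFieldNormedType.Exports.
Local Open Scope classical_set_scope.
Local Open Scope ring_scope.

(** Write S_N(n) for the truncation m_1 <= N of the zeta-star series of
    (3,1,...,3,1), put q = x^4 and let A*_N = sum_n S_N(n) q^n.  Peeling off the
    largest index gives A*_N = A*_(N-1) + (q/N^3) B*_N and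
    B*_N = B*_(N-1) + (1/N) A*_N, where B* belongs to the words (1,3,1,...,3,1).
    Solving this 2 x 2 linear system for (A*_N, B*_N) divides by its determinant
    1 - q/N^4 and leaves exactly the recurrence of the truncated series with
    strict inequalities m_1 > m_2 > ...; call A_N the generating function of the
    latter.  Hence, already at finite level [zeta31_star],
      A*_N = A_N / prod_(k <= N) (1 - x^2/k^2) (1 + x^2/k^2).

    The limit of A_N comes from a hypergeometric product.  For q = -4 c^2, A_N is
    the sum of the coefficients of t^0, ..., t^N in F_c(t) F_(-c)(t), where
    F_c = 2F1(a, -a; 1; t) and a^2 = c, because the product satisfies
    ((1-t) d/dt)^2 (t d/dt)^2 Y = q Y [zeta31_hyper].  The partial sums of F_c at
    t = 1 telescope to prod_(k <= N) (1 - c/k^2), and the Cauchy product of the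
    two series converges coefficientwise in c [cauchy_truncation], so A_N tends
    to prod_k (1 - c^2/k^4).  Euler's product for sin (pi x)/(pi x), in the form
    of the limits of the elementary symmetric functions of the 1/k^2
    [cvg_elsym_inv_sq], then gives the coefficients 2 pi^(4n)/(4n+2)!
    [cvg_zeta31_poly].

    The factors 1/(1 -+ x^2/k^2) tend to pi x/sin (pi x) and pi x/sinh (pi x).
    Their coefficients are the (2^(2j)-2) B_(2j) pi^(2j)/(2j)! up to sign, since
    t/sinh t = 2 b(t) - b(2t) for b(t) = t/(e^t - 1) [bernoulli_sinhc].  Comparing
    coefficients in A*_N, and letting N grow, gives the formula [cvg_star_sum].

    All generating functions are formal power series, and all limits are limits
    of single coefficients; convergence of power series only enters to identify
    the Bernoulli numbers with the coefficients of a formal inverse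
    [bernoulli_expquot]. *)

(** * Formal power series *)

(** A separate name for the type of sequences, so that multiplication is the
    Cauchy product and not the pointwise one. *)
Definition fps (K : comNzRingType) := nat -> K.

Section FormalSeries.
Variable K : comNzRingType.
HB.instance Definition _ := GRing.Zmodule.copy (fps K) (nat -> K).

Definition fps_of_poly (p : {poly K}) : fps K := fun n => p`_n.
Definition fps_mul (f g : fps K) : fps K :=
  fun n => \sum_(i < n.+1) f i * g (n - i)%N.
Definition fps_trunc m (f : fps K) : {poly K} := \poly_(i < m) f i.

(** Reduces the ring axioms to those of polynomials: a coefficient of a product
    only depends on truncations of the factors. *)
Lemma fps_mul_trunc m f g n : (n < m)%N ->
  fps_mul f g n = (fps_trunc m f * fps_trunc m g)`_n.
Proof.
move=> nm; rewrite coefM; apply: eq_bigr => i _.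
by rewrite !coef_poly !ifT //; have := ltn_ord i; lia.
Qed.

Lemma fps_mulC : commutative fps_mul.
Proof.
by move=> f g; apply/funext => n; rewrite !(@fps_mul_trunc n.+1)// mulrC.
Qed.

Lemma fps_mulA : associative fps_mul.
Proof.
suff tr f g h n : fps_mul (fps_mul f g) h n =
    (fps_trunc n.+1 f * fps_trunc n.+1 g * fps_trunc n.+1 h)`_n.
  move=> f g h; apply/funext => n.
  by rewrite fps_mulC !tr mulrC mulrA.
rewrite coefM; apply: eq_bigr => i _; have := ltn_ord i => lin.
rewrite [fps_mul f g i](@fps_mul_trunc n.+1)//.
by rewrite [in RHS]/fps_trunc coef_poly ifT//; lia.
Qed.

Lemma fps_mul1 : left_id (fps_of_poly 1) fps_mul.
Proof.
move=> f; apply/funext => n; rewrite (@fps_mul_trunc n.+1)//.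
rewrite [fps_trunc _ _](_ : _ = 1) ?mul1r ?coef_poly ?ltnSn//.
by apply/polyP => -[|i]; rewrite coef_poly /fps_of_poly// coef1 if_same.
Qed.

Lemma fps_mulDl : left_distributive fps_mul +%R.
Proof.
move=> f g h; apply/funext => n.
transitivity (fps_mul f h n + fps_mul g h n) => //.
by rewrite /fps_mul -big_split/=; apply: eq_bigr => i _; rewrite -mulrDl.
Qed.

Lemma fps_one_neq0 : fps_of_poly 1 != 0.
Proof.
apply/eqP => /(congr1 (fun f : fps K => f 0%N)).
by rewrite /fps_of_poly coef1 => /eqP; rewrite oner_eq0.
Qed.

HB.instance Definition _ := GRing.Zmodule_isComNzRing.Build (fps K)
  fps_mulA fps_mulC fps_mul1 fps_mulDl fps_one_neq0.

Lemma fpsM (f g : fps K) n : (f * g) n = \sum_(i < n.+1) f i * g (n - i)%N.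
Proof. by []. Qed.
Lemma fpsD (f g : fps K) n : (f + g) n = f n + g n. Proof. by []. Qed.
Lemma fpsN (f : fps K) n : (- f) n = - f n. Proof. by []. Qed.
Lemma fpsB (f g : fps K) n : (f - g) n = f n - g n. Proof. by []. Qed.
Lemma fps1 n : (1 : fps K) n = (n == 0%N)%:R.
Proof. exact: coef1. Qed.
Lemma fps_ofE (p : {poly K}) n : fps_of_poly p n = p`_n. Proof. by []. Qed.

Lemma fps_of_poly_is_zmod : zmod_morphism fps_of_poly.
Proof. by move=> p q; apply/funext => n; rewrite fpsB /fps_of_poly coefB. Qed.
Lemma fps_of_poly_is_monoid : monoid_morphism fps_of_poly.
Proof.
split=> // p q; apply/funext => n; rewrite /fps_of_poly fpsM; exact: coefM.
Qed.
HB.instance Definition _ := GRing.isZmodMorphism.Build {poly K} (fps K)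
  fps_of_poly fps_of_poly_is_zmod.
HB.instance Definition _ := GRing.isMonoidMorphism.Build {poly K} (fps K)
  fps_of_poly fps_of_poly_is_monoid.
End FormalSeries.


(** * The transfer recurrence and the hypergeometric product *)

Section Derivation.
Variable K : comNzRingType.
Implicit Types f g : fps K.

Definition fpsX : fps K := fps_of_poly 'X.
Definition fpsC (c : K) : fps K := fps_of_poly c%:P.

HB.instance Definition _ :=
  GRing.RMorphism.copy fpsC (@fps_of_poly K \o @polyC K).

Lemma fpsXE n : fpsX n = (n == 1%N)%:R. Proof. exact: coefX. Qed.
Lemma fpsCE c n : fpsC c n = if n == 0%N then c else 0.
Proof. exact: coefC. Qed.

Lemma fpsXM f n : (fpsX * f) n = if n is m.+1 then f m else 0.
Proof.
rewrite [LHS](@fps_mul_trunc _ n.+2)// [fps_trunc _ _](_ : _ = 'X).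
  by rewrite coefXM; case: n => [|n]//=; rewrite coef_poly ifT//; lia.
apply/polyP => i; rewrite coef_poly fpsXE coefX.
by case: i => [|[|i]]; rewrite ?if_same.
Qed.

Lemma fpsCM c f n : (fpsC c * f) n = c * f n.
Proof.
rewrite fpsM big_ord_recl fpsCE/= subn0 big1 ?addr0// => i _.
by rewrite fpsCE mul0r.
Qed.

Definition fps_deriv f : fps K := fun n => f n.+1 *+ n.+1.

Lemma fps_derivD f g : fps_deriv (f + g) = fps_deriv f + fps_deriv g.
Proof. by apply/funext => n; rewrite /fps_deriv !fpsD mulrnDl. Qed.

Lemma fps_derivN f : fps_deriv (- f) = - fps_deriv f.
Proof. by apply/funext => n; rewrite /fps_deriv !fpsN mulNrn. Qed.

Lemma fps_derivM f g : fps_deriv (f * g) = fps_deriv f * g + f * fps_deriv g.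
Proof.
apply/funext => n; rewrite /fps_deriv fpsD.
rewrite [(f * g) _](@fps_mul_trunc _ n.+2)// -coef_deriv derivM coefD !coefM.
congr (_ + _); apply: eq_bigr => i _; rewrite ?coef_deriv !coef_poly !ifT//;
  have := ltn_ord i; lia.
Qed.

Lemma fps_derivX : fps_deriv fpsX = 1.
Proof.
apply/funext => -[|n]; rewrite /fps_deriv fpsXE fps1//.
by rewrite mul0rn.
Qed.

Lemma fps_derivC c : fps_deriv (fpsC c) = 0.
Proof. by apply/funext => n; rewrite /fps_deriv fpsCE mul0rn. Qed.

Lemma fps_deriv1 : fps_deriv 1 = 0.
Proof. by rewrite -(fps_derivC 1) rmorph1. Qed.

Definition fps_derivE := (fps_derivD, fps_derivN, fps_derivM, fps_derivX, fps_derivC,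
  fps_deriv1).

Definition fps_geom (a : K) : fps K := fun n => a ^+ n.

Lemma fps_geomE a : (1 - fpsC a * fpsX) * fps_geom a = 1.
Proof.
apply/funext => n; rewrite mulrBl mul1r fpsB -mulrA fpsCM fpsXM fps1.
by case: n => [|n]; rewrite /fps_geom ?mulr0 ?subr0// exprS subrr.
Qed.

End Derivation.

Section TransferMatrix.
Variables (K : comNzRingType) (q : K) (w : nat -> K).

(** The pair of the generating functions in q of the truncations m_1 <= N of
    zeta(3,1,...,3,1) and zeta(1,3,1,...,3,1), with strict inequalities between
    the indices; [w k] stands for 1/(k+1). *)
Fixpoint zeta31 N : K * K :=
  if N is M.+1 then
    let: (a, b) := zeta31 M in (a + q * w M ^+ 3 * b, b + w M * a)
  else (1, 0).

Lemma zeta31S N : zeta31 N.+1 =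
 ((zeta31 N).1 + q * w N ^+ 3 * (zeta31 N).2, (zeta31 N).2 + w N * (zeta31 N).1).
Proof. by rewrite /=; case: zeta31. Qed.

(** The star system is implicit: A and B at N.+1 occur on both sides.  Its matrix
    has determinant 1 - q w^4, and its adjugate is the transfer matrix of
    [zeta31]. *)
Lemma zeta31_star (A B : nat -> K) :
  A 0%N = 1 -> B 0%N = 0 ->
  (forall N, B N.+1 = B N + w N * A N.+1) ->
  (forall N, A N.+1 = A N + q * w N ^+ 3 * B N.+1) ->
  forall N, A N * \prod_(i < N) (1 - q * w i ^+ 4) = (zeta31 N).1.
Proof.
move=> A0 B0 eB eA N.
suff: A N * \prod_(i < N) (1 - q * w i ^+ 4) = (zeta31 N).1 /\
      B N * \prod_(i < N) (1 - q * w i ^+ 4) = (zeta31 N).2 by case.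
elim: N => [|N [IA IB]]; first by rewrite A0 B0 big_ord0 mulr1 mul0r.
rewrite zeta31S/= -IA -IB big_ord_recr/=; set P := \prod_(i < N) _; split.
- transitivity (P * (A N.+1 - q * w N ^+ 4 * A N.+1)); first by ring.
  by rewrite {1}eA eB; ring.
- transitivity (P * (B N.+1 - q * w N ^+ 4 * B N.+1)); first by ring.
  by rewrite {1}eB eA; ring.
Qed.
End TransferMatrix.

Section Hypergeometric.
Variables (K : comNzRingType) (w : nat -> K).
Hypothesis wE : forall k, k.+1%:R * w k = 1.

(** [hprod] is the closed form of the partial sums of [hyper] at t = 1, so each
    coefficient of [hyper c] is a difference of consecutive values of it.
    [hyper c] is 2F1(a, -a; 1; t) with a^2 = c; this presentation avoids a square
    root of c. *)
Definition hprod c N : K := \prod_(i < N) (1 - c * w i ^+ 2).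
Definition hyper c : fps K :=
  fun n => if n is k.+1 then - c * w k ^+ 2 * hprod c k else 1.

Local Notation D := (@fps_deriv K).
Local Notation t := (fpsX K).

(** The operator (1-t) d/dt (t d/dt) sends the series of f_n to that of
    (n+1)^2 f_(n+1) - n^2 f_n, and (n+1)^2 f_(n+1) = (n^2 - c) f_n. *)
Lemma hyper_ode c :
  (1 - t) * (D (hyper c) + t * D (D (hyper c))) = - fpsC c * hyper c.
Proof.
have -> : D (hyper c) + t * D (D (hyper c)) = D (t * D (hyper c)).
  by rewrite !fps_derivE mul1r.
apply/funext => n; rewrite mulrBl mul1r fpsB fpsXM mulNr fpsN fpsCM.
have E k : D (t * D (hyper c)) k = - c * hprod c k.
  rewrite /fps_deriv fpsXM/= /fps_deriv/= -mulrnA -mulr_natr natrM.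
  transitivity (- c * hprod c k * (k.+1%:R * w k) ^+ 2); first by ring.
  by rewrite wE expr1n mulr1.
case: n => [|n]; rewrite !E /hyper /hprod ?big_ord0 ?big_ord_recr/=; ring.
Qed.

(** With th = t d/dt and ph = (1-t) d/dt, the equations for F and G are
    ph th F = - c F and ph th G = c G.  As (1-t) th = t ph, the terms (th^2 F) G
    and F (th^2 G) cancel, so th^2 (F G) = 2 (th F) (th G).  Applying ph gives
    2 c (th F G - F th G), and once more, since th F ph G = ph F th G, gives
    - 4 c^2 F G. *)
Lemma hyper_product_ode c (F := hyper c) (G := hyper (- c)) :
  (1 - t) * D ((1 - t) * D (t * D (t * D (F * G)))) =
    - fpsC (4 * c ^+ 2) * (F * G).
Proof.
have HF := hyper_ode c; have HG := hyper_ode (- c); rewrite -/F -/G in HF HG.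
have HG' : (1 - t) * (D G + t * D (D G)) = fpsC c * G.
  by rewrite HG rmorphN opprK.
have W : t * D (t * D (F * G)) = 2 * t ^+ 2 * D F * D G.
  have cancel1 (f g : fps K) : (1 - t) * f = (1 - t) * g -> f = g.
    move=> /(congr1 ( *%R (fps_geom (1 : K)))); rewrite !mulrA.
    suff -> : fps_geom (1 : K) * (1 - t) = 1 by rewrite !mul1r.
    by rewrite -[RHS](fps_geomE (1 : K)) mulrC rmorph1 mul1r.
  apply: cancel1; rewrite !fps_derivE.
  transitivity (t * (((1 - t) * (D F + t * D (D F))) * G
     + ((1 - t) * (D G + t * D (D G))) * F + (1 - t) * 2 * t * D F * D G)).
    by ring.
  by rewrite HF HG'; ring.
have Z : (1 - t) * D (t * D (t * D (F * G))) =
    2 * fpsC c * t * (D F * G - F * D G).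
  rewrite W !exprS expr0 !fps_derivE.
  transitivity (2 * t * (((1 - t) * (D F + t * D (D F))) * D G
     + ((1 - t) * (D G + t * D (D G))) * D F)); first by ring.
  by rewrite HF HG'; ring.
rewrite Z !fps_derivE.
transitivity (2 * fpsC c * (((1 - t) * (D F + t * D (D F))) * G
     - ((1 - t) * (D G + t * D (D G))) * F)); first by ring.
by rewrite HF HG'; ring.
Qed.

(** The differential equation says that n^3 y_n and n z_n, for y the coefficients
    of Y = F G and z those of ph th^2 Y, have differences z_n and q y_n.  Summing
    twice gives the recurrence of [zeta31]. *)
Lemma zeta31_hyper c N :
  (zeta31 (- 4 * c ^+ 2) w N).1 = \sum_(m < N.+1) (hyper c * hyper (- c)) m.
Proof.
set q := - 4 * _; set Y := hyper c * hyper (- c).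
pose Z : fps K := (1 - t) * D (t * D (t * D Y)).
have ZE n : Z n = Y n.+1 * n.+1%:R ^+ 3 - Y n * n%:R ^+ 3.
  rewrite /Z mulrBl mul1r fpsB fpsXM /fps_deriv.
  case: n => [|n]; rewrite !fpsXM; first by ring.
  have natE (x : K) k : x *+ k *+ k *+ k = x * k%:R ^+ 3.
    by rewrite -!mulrnA -[LHS]mulr_natr !natrM; ring.
  by rewrite !natE.
have YE n : Z n.+1 * n.+1%:R - Z n * n%:R = q * Y n.
  have := congr1 (fun f : fps K => f n) (hyper_product_ode c).
  rewrite -/Y -/Z mulrBl mul1r fpsB fpsXM mulNr fpsN fpsCM /q !mulNr => <-.
  by rewrite /fps_deriv; case: n => [|n]; rewrite ?mulr0 !mulr_natr.
have ZS n : Z n.+1 * n.+1%:R = q * \sum_(m < n.+1) Y m.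
  elim: n => [|n IH]; first by rewrite big_ord1 -YE mulr0 subr0.
  by have E := YE n.+1; rewrite IH in E; rewrite big_ord_recr/= [RHS]mulrDr -E; ring.
suff: (zeta31 q w N).1 = \sum_(m < N.+1) Y m /\
      q * (zeta31 q w N).2 = Y N.+1 * N.+1%:R ^+ 3 by case.
elim: N => [|N [IA IB]].
  rewrite big_ord1 /Y !fpsM !big_ord_recl !big_ord0/= /hprod !big_ord0.
  by split; ring.
rewrite zeta31S [(_, _).1]/= [(_, _).2]/=; split.
  rewrite big_ord_recr/= -IA; congr (_ + _).
  transitivity (q * (zeta31 q w N).2 * w N ^+ 3); first by ring.
  rewrite IB; transitivity (Y N.+1 * (N.+1%:R * w N) ^+ 3); first by ring.
  by rewrite wE expr1n mulr1.
rewrite mulrDr IB.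
transitivity (Y N.+1 * N.+1%:R ^+ 3 + w N * (q * (zeta31 q w N).1)).
  by ring.
rewrite IA -ZS.
transitivity (Y N.+1 * N.+1%:R ^+ 3 + Z N.+1 * (N.+1%:R * w N)); first by ring.
by rewrite wE mulr1 ZE; ring.
Qed.
End Hypergeometric.

(** * Multiple-angle polynomials in the tangent *)

Section TangentPolynomial.
Variable R : comNzRingType.

(** (1 + i t)^n = u (t^2) + i t v (t^2) for (u, v) the value at n: the real and
    imaginary parts of de Moivre's formula divided by cos^n. *)
Fixpoint tanpoly n : {poly R} * {poly R} :=
  if n is m.+1 then
    let: (u, v) := tanpoly m in (u - 'X * v, u + v)
  else (1, 0).

Lemma tanpolyS n : tanpoly n.+1 =
  ((tanpoly n).1 - 'X * (tanpoly n).2, (tanpoly n).1 + (tanpoly n).2).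
Proof. by rewrite /=; case: tanpoly. Qed.

Lemma coef_tanpoly n j :
  (tanpoly n).1`_j = (-1) ^+ j * 'C(n, j.*2)%:R /\
  (tanpoly n).2`_j = (-1) ^+ j * 'C(n, j.*2.+1)%:R.
Proof.
elim: n j => [|n IH] j.
  by rewrite /= coef1 coef0; case: j => [|j] /=; rewrite !mulr0 ?mulr1.
rewrite tanpolyS/= coefB coefXM coefD; split; last first.
  by have [-> ->] := IH j; rewrite binS natrD; ring.
case: j => [|j]/=; first by have [-> _] := IH 0%N; rewrite !bin0 subr0.
have [-> _] := IH j.+1; have [_ ->] := IH j.
by rewrite doubleS binS natrD exprS; ring.
Qed.

(** At t = 1 this is the imaginary part of (1 + i)^(4n+2) = 2 i (-4)^n. *)
Lemma tanpoly_at1 n : (tanpoly (4 * n + 2)).2.[1] = 2 * (-4) ^+ n.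
Proof.
have step m : (tanpoly m.+4).1.[1] = - 4 * (tanpoly m).1.[1] /\
              (tanpoly m.+4).2.[1] = - 4 * (tanpoly m).2.[1].
  by rewrite !tanpolyS/= !(hornerD, hornerN, hornerM, hornerX, hornerC); split; ring.
suff: (tanpoly (4 * n + 2)).1.[1] = 0 /\
      (tanpoly (4 * n + 2)).2.[1] = 2 * (-4) ^+ n by case.
elim: n => [|n [IH1 IH2]]; first by rewrite /= !(hornerD, hornerN, hornerM, hornerX, hornerC); split; ring.
rewrite (_ : 4 * n.+1 + 2 = (4 * n + 2).+4)%N; last by lia.
by have [-> ->] := step (4 * n + 2)%N; rewrite IH1 IH2 exprS; split; ring.
Qed.

Lemma size_tanpoly2 m : (size (tanpoly m.*2.+1).2 <= m.+1)%N.
Proof.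
apply/leq_sizeP => j mj; have [_ ->] := coef_tanpoly m.*2.+1 j.
by rewrite bin_small ?mulr0//; lia.
Qed.

End TangentPolynomial.

Lemma cos_sin_muln (R : realType) (x : R) n : cos x != 0 ->
  cos (x *+ n) = cos x ^+ n * (tanpoly R n).1.[tan x ^+ 2] /\
  sin (x *+ n) = cos x ^+ n * tan x * (tanpoly R n).2.[tan x ^+ 2].
Proof.
move=> cx0; elim: n => [|n [IHc IHs]].
  by rewrite mulr0n cos0 sin0 /= !(hornerD, hornerN, hornerM, hornerX, hornerC); split; ring.
have sE : sin x = cos x * tan x by rewrite /tan mulrC divfK.
rewrite tanpolyS mulrS cosD sinD IHc IHs/= !(hornerD, hornerN, hornerM, hornerX, hornerC) sE.
by rewrite [cos x ^+ n.+1]exprS; split; ring.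
Qed.

(** The coefficient of y^(4n+2) in sin y sinh y; multiplied by (4n+2)! it is an
    alternating sum of binomial coefficients, the value of [tanpoly_at1]. *)
Lemma sum_alternating_inv_fact (R : numFieldType) n :
  \sum_(i < (2 * n).+1) (-1) ^+ i / ((2 * i).+1)`!%:R
     * ((2 * (2 * n - i)).+1)`!%:R^-1 = 2 * (-4) ^+ n / (4 * n + 2)`!%:R :> R.
Proof.
rewrite -tanpoly_at1 (@horner_coef_wide _ (2 * n).+1); last first.
  have -> : (4 * n + 2 = (2 * n).*2.+2)%N by lia.
  rewrite tanpolyS/=; apply/leq_sizeP => j jn; rewrite coefD.
  have [-> ->] := coef_tanpoly R (2 * n).*2.+1 j.
  by rewrite !bin_small ?mulr0 ?addr0//; lia.
rewrite mulr_suml; apply: eq_bigr => i _; have := ltn_ord i => lin.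
have [_ ->] := coef_tanpoly R (4 * n + 2) i.
rewrite expr1n mulr1 -!mulrA; congr (_ * _).
have -> : (2 * (2 * n - i)).+1 = (4 * n + 2 - (i.*2.+1))%N by lia.
rewrite -(@bin_fact (4 * n + 2) i.*2.+1); last by lia.
rewrite mul2n !natrM !invfM [RHS]mulrA mulfV ?mul1r//.
by rewrite pnatr_eq0 -lt0n bin_gt0; lia.
Qed.

(** * Elementary symmetric functions and Euler's sine product *)

Section ElementarySymmetric.
Variable K : comNzRingType.
Implicit Type u : nat -> K.

Definition eprod u N : {poly K} := \prod_(i < N) (1 + (u i)%:P * 'X).
Definition elsym u N j : K := (eprod u N)`_j.

Lemma elsym_none u j : elsym u 0 j = (j == 0%N)%:R.
Proof. by rewrite /elsym /eprod big_ord0 coef1. Qed.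

Lemma elsymS u N j :
  elsym u N.+1 j = elsym u N j + u N * (if j is k.+1 then elsym u N k else 0).
Proof.
rewrite /elsym /eprod big_ord_recr/= mulrDr mulr1 coefD mulrC -mulrA coefCM.
by rewrite coefXM; case: j.
Qed.

Lemma elsym0 u N : elsym u N 0 = 1.
Proof. by elim: N => [|N IH]; rewrite ?elsym_none// elsymS IH mulr0 addr0. Qed.

Lemma elsymZ s u N j : elsym (fun i => s * u i) N j = s ^+ j * elsym u N j.
Proof.
elim: N j => [|N IH] j; first by rewrite !elsym_none; case: j => [|j]; rewrite ?expr0 ?mulr1 ?mulr0.
by rewrite !elsymS IH; case: j => [|j]; rewrite ?IH ?exprS; ring.
Qed.

End ElementarySymmetric.

Section ElementarySymmetricOrder.
Variable R : realFieldType.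
Implicit Type u v : nat -> R.

Lemma elsym_ge0 u N j : (forall i, 0 <= u i) -> 0 <= elsym u N j.
Proof.
move=> u0; elim: N j => [|N IH] j; first by rewrite elsym_none.
by rewrite elsymS addr_ge0// mulr_ge0//; case: j.
Qed.

Lemma le_elsym u v N j : (forall i, (i < N)%N -> 0 <= u i <= v i) ->
  0 <= elsym u N j <= elsym v N j.
Proof.
elim: N j => [|N IH] j uv; first by rewrite !elsym_none lexx andbT.
have {}IH k : 0 <= elsym u N k <= elsym v N k.
  by apply: IH => i iN; apply: uv; apply: ltnW.
have /andP[u0 uvN] := uv N (ltnSn N).
rewrite !elsymS; case: j => [|j]; first by rewrite !mulr0 !addr0.
have /andP[a0 ab] := IH j.+1; have /andP[c0 cd] := IH j.
by rewrite addr_ge0 ?mulr_ge0//= lerD// ler_pM.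
Qed.

Lemma elsym_homo u M N j : (forall i, 0 <= u i) -> (M <= N)%N ->
  elsym u M j <= elsym u N j.
Proof.
move=> u0; elim: N => [|N IH]; first by rewrite leqn0 => /eqP ->.
rewrite leq_eqVlt => /predU1P[-> //|]; rewrite ltnS => /IH /le_trans; apply.
by rewrite elsymS lerDl mulr_ge0//; case: (j) => // k; exact: elsym_ge0.
Qed.
End ElementarySymmetricOrder.

(** Continuity in the variables for a fixed number of them; together with the
    monotonicity above this is the dominated convergence used for Euler's
    product. *)
Lemma cvg_elsym (R : realType) (u_ : nat -> nat -> R) (u : nat -> R) N j :
  (forall i, (u_ n i) @[n --> \oo] --> u i) ->
  (elsym (u_ n) N j) @[n --> \oo] --> elsym u N j.
Proof.
move=> uu; elim: N j => [|N IH] j.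
  rewrite (_ : (fun n => _) = fun=> elsym u 0 j); first exact: cvg_cst.
  by apply/funext => n; rewrite !elsym_none.
rewrite elsymS (_ : (fun n => _) = fun n => elsym (u_ n) N j +
    u_ n N * (if j is k.+1 then elsym (u_ n) N k else 0)); last first.
  by apply/funext => n; rewrite elsymS.
apply: cvgD; first exact: IH.
apply: cvgM; first exact: uu.
by case: j => [|j]; [exact: cvg_cst|exact: IH].
Qed.

Section Cotangents.
Variable R : realType.
Implicit Types x y : R.

Lemma sin_le_self x : 0 <= x -> sin x <= x.
Proof.
move=> x0; have [|c _] := @MVT_segment R sin cos 0 x x0.
  by apply: continuous_subspaceT; exact: continuous_sin.
by rewrite sin0 !subr0 => ->; rewrite ler_piMl// cos_le1.
Qed.

Lemma self_le_tan x : 0 <= x < pi / 2 -> x <= tan x.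
Proof.
move=> /andP[x0 xpi].
have cp y : 0 <= y <= x -> 0 < cos y.
  move=> /andP[y0 yx]; apply: cos_gt0_pihalf; have := @pi_gt0 R; lra.
have [|| c cI] := @MVT_segment R tan (fun y => (cos y) ^- 2) 0 x x0.
- move=> y; rewrite in_itv/= => /andP[y0 yx]; apply: is_derive_tan.
  by rewrite gt_eqF// cp// !ltW.
- apply/continuous_in_subspaceT => y; rewrite inE/= in_itv/= => yI.
  by apply: continuous_tan; rewrite gt_eqF// cp.
rewrite tan0 !subr0 => ->; rewrite ler_peMl// invf_ge1; last first.
  by rewrite exprn_gt0// cp//; move: cI; rewrite in_itv.
by rewrite expr_le1// ?cos_le1// ltW// cp//; move: cI; rewrite in_itv.
Qed.

Definition cotsq N i : R := (tan (i.+1%:R * pi / N.*2.+1%:R)) ^- 2.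

Lemma node_bounds N i : (i < N)%N -> 0 < i.+1%:R * @pi R / N.*2.+1%:R < pi / 2.
Proof.
move=> iN; have pi0 := @pi_gt0 R.
rewrite divr_gt0 ?mulr_gt0//= ltr_pdivrMr// mulrAC ltr_pdivlMr//.
rewrite -mulrA [ltLHS]mulrC -mulrA ltr_pM2l// -natrM ltr_nat; lia.
Qed.

(** The roots of v at n = 2N+1 are the squares of tan (k pi/n) for k = 1, ..., N,
    because sin (n x) vanishes at these points; there are as many as its degree.
    Its constant term is n. *)
Lemma eprod_cotsq N :
  (tanpoly R N.*2.+1).2 = N.*2.+1%:R *: eprod (fun i => - cotsq N i) N.
Proof.
set n := N.*2.+1; set v := (tanpoly R n).2.
pose y i : R := i.+1%:R * pi / n%:R.
have yI i : (i < N)%N -> 0 < y i < pi / 2 by exact: node_bounds.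
have cos0 i : (i < N)%N -> cos (y i) != 0.
  move=> /yI yi; rewrite gt_eqF// cos_gt0_pihalf//; have := @pi_gt0 R; lra.
have tan_gt0 i : (i < N)%N -> 0 < tan (y i).
  move=> /yI/andP[y0 yi]; apply: (lt_le_trans y0); apply: self_le_tan.
  by rewrite yi ltW.
pose rs := [seq tan (y i) ^+ 2 | i <- iota 0 N].
have sz : size v = (size rs).+1.
  rewrite size_map size_iota; apply/eqP; rewrite eqn_leq size_tanpoly2/=.
  rewrite ltnNge; apply/negP => /leq_sizeP/(_ N (leqnn _)).
  have [_ ->] := coef_tanpoly R n N; rewrite binn mulr1 => /eqP.
  by rewrite signr_eq0.
have rt : all (root v) rs.
  apply/allP => _ /mapP[i + ->]; rewrite mem_iota/= add0n => iN.
  have [_ ] := cos_sin_muln n (cos0 i iN).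
  rewrite -[y i *+ n]mulr_natr /y mulfVK ?pnatr_eq0// -/(y i).
  have -> : sin (i.+1%:R * pi) = 0 :> R.
    by elim: i.+1 => [|k IH]; rewrite ?mul0r ?sin0// -natr1 mulrDl mul1r sinDpi IH oppr0.
  move/esym/eqP; rewrite mulf_eq0 => /orP[|//]; rewrite mulf_eq0 expf_eq0.
  by rewrite (negbTE (cos0 i iN)) andbF/= (gt_eqF (tan_gt0 i iN)).
have uq : uniq rs.
  rewrite map_inj_in_uniq ?iota_uniq// => i k.
  rewrite !mem_iota/= !add0n => iN kN /eqP.
  rewrite eqrXn2// ?ltW ?tan_gt0// => /eqP /tan_inj.
  rewrite !in_itv/= => H.
  have : y i = y k by apply: H; [have := yI i iN|have := yI k kN]; lra.
  have yE k' : y k' * n%:R / pi = k'.+1%:R.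
    by rewrite /y mulfVK ?pnatr_eq0// mulfK// gt_eqF ?pi_gt0.
  by move/(congr1 (fun z => z * n%:R / pi)); rewrite !yE => /eqP; rewrite eqr_nat => /eqP [].
have vE := all_roots_prod_XsubC sz rt; rewrite uniq_rootsE in vE.
have {vE} := vE uq; rewrite big_map -[in iota _ _](subn0 N) big_mkord.
under eq_bigr => i _.
  have -> : 'X - (tan (y i) ^+ 2)%:P =
      (- tan (y i) ^+ 2)%:P * (1 + (- cotsq N i)%:P * 'X).
    rewrite mulrDr mulr1 mulrA -polyCM mulrNN /cotsq -/n -/(y i) mulfV.
      by rewrite polyC1 mul1r polyCN addrC.
    by rewrite expf_neq0// gt_eqF// tan_gt0.
  over.
rewrite big_split/= -rmorph_prod -/(eprod _ N) mul_polyC scalerA.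
set c := _ * _ => vE.
have := congr1 (fun p : {poly R} => p`_0) vE.
rewrite coefZ (elsym0 (fun i => - cotsq N i) N : _`_0 = 1) mulr1.
have [_ ->] := coef_tanpoly R n 0.
by rewrite bin1 expr0 mul1r vE => ->.
Qed.

Lemma elsym_cotsq N j :
  elsym (fun i => N.*2.+1%:R ^- 2 * cotsq N i) N j =
  (N.*2.+1 ^_ j.*2.+1)%:R / N.*2.+1%:R ^+ j.*2.+1 / (j.*2.+1)`!%:R.
Proof.
have := congr1 (fun p : {poly R} => p`_j) (eprod_cotsq N).
have [_ ->] := coef_tanpoly R N.*2.+1 j.
rewrite coefZ -/(elsym _ N j) elsymZ.
rewrite (_ : (fun i => - cotsq N i) = (fun i => -1 * cotsq N i)); last first.
  by apply/funext => i; rewrite mulN1r.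
rewrite elsymZ mulrCA => /(mulfI _) H.
have {H} : 'C(N.*2.+1, j.*2.+1)%:R = N.*2.+1%:R * elsym (cotsq N) N j :> R.
  by apply: H; rewrite signr_eq0.
move=> /(congr1 (fun z => z * N.*2.+1%:R^-1)).
rewrite mulrAC mulfV ?pnatr_eq0// mul1r => <-.
rewrite -bin_ffact natrM -exprVn -exprM mul2n exprS.
set F := (_ `!)%:R; have F0 : F != 0 :> R by rewrite pnatr_eq0 -lt0n fact_gt0.
rewrite [RHS]mulrAC mulfK// exprVn invfM.
ring.
Qed.

Lemma ffact_le_expn n k : (n ^_ k <= n ^ k)%N.
Proof.
elim: k => [|k IH]; first by rewrite ffactn0.
by rewrite ffactnSr expnSr leq_mul// leq_subr.
Qed.

Lemma cvg_ffact_ratio k :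
  ((N.*2.+1 ^_ k)%:R / N.*2.+1%:R ^+ k : R) @[N --> \oo] --> (1 : R).
Proof.
have cvg_inv : (N.*2.+1%:R^-1 : R) @[N --> \oo] --> (0 : R).
  apply: (@squeeze_cvgr _ _ _ _ (fun=> 0) harmonic); last 2 first.
  - exact: cvg_cst.
  - exact: cvg_harmonic.
  apply: nearW => N; rewrite invr_ge0 ler0n/= lef_pV2 ?posrE ?ltr0n//.
  by rewrite ler_nat; lia.
elim: k => [|k IH].
  rewrite (_ : (fun N => _) = fun=> 1); first exact: cvg_cst.
  by apply/funext => N; rewrite ffactn0 expr0 divr1.
have : ((N.*2.+1 ^_ k)%:R / N.*2.+1%:R ^+ k * (1 - k%:R / N.*2.+1%:R) : R)
    @[N --> \oo] --> (1 * (1 - k%:R * 0) : R).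
  apply: cvgM => //; apply: cvgB; first exact: cvg_cst.
  by apply: cvgM => //; exact: cvg_cst.
rewrite mulr0 subr0 mulr1; apply: cvg_trans; apply: near_eq_cvg.
near=> N; have kN : (k <= N.*2.+1)%N.
  have : (k <= N)%N by near: N; exact: nbhs_infty_ge.
  lia.
rewrite ffactnSr natrM natrB// exprSr invfM.
have n0 : N.*2.+1%:R != 0 :> R by rewrite pnatr_eq0.
by field; rewrite expf_neq0 // addrC natr1 n0.
Unshelve. all: by end_near. Qed.

Definition inv_sq i : R := i.+1%:R ^- 2.

(** Euler's product sin (pi x)/(pi x) = prod (1 - x^2/k^2), coefficient by
    coefficient.  With y = k pi/n, sin y <= y <= tan y gives
    1/y^2 - 1 <= cot^2 y <= 1/y^2.  Hence (cot^2 y)/n^2 is below, and tends to,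
    1/(pi k)^2, while the elementary symmetric functions of all N of these
    numbers are the explicit ratios of [elsym_cotsq]. *)
Lemma cvg_elsym_inv_sq j :
  elsym inv_sq N j @[N --> \oo] --> pi ^+ (2 * j) / (2 * j).+1`!%:R.
Proof.
pose F : R := (j.*2.+1)`!%:R^-1.
pose a i : R := pi ^- 2 * inv_sq i.
have pi0 := @pi_gt0 R.
have a0 i : 0 <= a i by rewrite /a /inv_sq mulr_ge0// invr_ge0 exprn_ge0// ltW.
pose c N i : R := N.*2.+1%:R ^- 2 * cotsq N i.
have c_bounds N i : (i < N)%N -> a i - N.*2.+1%:R ^- 2 <= c N i <= a i.
  move=> iN; have /andP[y0 ypi] := node_bounds iN.
  rewrite /c /cotsq; set n : R := N.*2.+1%:R in y0 ypi *.
  set y : R := _ / n in y0 ypi *.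
  have n0 : 0 < n by rewrite ltr0n.
  have aE : a i = n ^- 2 * y ^- 2.
    have aux (m p r : R) : 0 < m -> 0 < p -> 0 < r ->
        p ^- 2 * m ^- 2 = r ^- 2 * (m * p / r) ^- 2.
      by move=> m0 p0 r0; field; rewrite !gt_eqF.
    exact: aux.
  have n20 : 0 < n ^- 2 by rewrite invr_gt0 exprn_gt0.
  have ty : y <= tan y by apply: self_le_tan; rewrite ltW.
  have t0 : 0 < tan y by exact: lt_le_trans ty.
  have cy0 : 0 < cos y by rewrite cos_gt0_pihalf// ypi andbT; lra.
  have sy0 : 0 < sin y by rewrite sin_gt0_pihalf// y0.
  have syy : sin y <= y by apply: sin_le_self; exact: ltW.
  rewrite aE; apply/andP; split.
    rewrite -[X in _ - X]mulr1 -mulrBr ler_pM2l//.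
    have -> : tan y ^- 2 = sin y ^- 2 - 1.
      have aux (s r : R) : s != 0 -> r != 0 -> r ^+ 2 + s ^+ 2 = 1 ->
          (s / r) ^- 2 = s ^- 2 - 1.
        move=> s0 r0 E; transitivity ((r ^+ 2 + s ^+ 2) / s ^+ 2 - 1).
          by field; rewrite s0.
        by rewrite E mul1r.
      by apply: aux; rewrite ?gt_eqF// cos2Dsin2.
    by rewrite lerB// lef_pV2 ?posrE ?exprn_gt0// lerXn2r// nnegrE ltW.
  by rewrite ler_pM2l// lef_pV2 ?posrE ?exprn_gt0// lerXn2r// nnegrE ltW.
have c0 N i : 0 <= c N i.
  by rewrite /c /cotsq mulr_ge0// invr_ge0 sqr_ge0.
have n2cvg : (N.*2.+1%:R ^- 2 : R) @[N --> \oo] --> (0 : R).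
  apply: (@squeeze_cvgr _ _ _ _ (fun=> 0) harmonic); last 2 first.
  - exact: cvg_cst.
  - exact: cvg_harmonic.
  apply: nearW => N; rewrite invr_ge0 exprn_ge0//= lef_pV2 ?posrE ?exprn_gt0//.
  by rewrite -natrX ler_nat; nia.
have c_cvg i : c N i @[N --> \oo] --> a i.
  apply: (@squeeze_cvgr _ _ _ _ (fun N => a i - N.*2.+1%:R ^- 2) (fun=> a i)).
  - near=> N; apply: c_bounds; near: N; exact: nbhs_infty_gt.
  - by rewrite -[X in _ --> X]subr0; apply: cvgB => //; exact: cvg_cst.
  - exact: cvg_cst.
(* Fix M variables and let n grow: dropping the variables beyond M only
   decreases the explicit value at n, which is at most F. *)
have upper M : elsym a M j <= F.
  apply: (cvgr_to_le (cvg_elsym c_cvg)).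
  near=> N; have MN : (M <= N)%N by near: N; exact: nbhs_infty_ge.
  apply: le_trans (elsym_homo _ (c0 N) MN) _.
  rewrite elsym_cotsq -/F ler_piMl ?invr_ge0// ler_pdivrMr ?exprn_gt0//.
  by rewrite mul1r -natrX ler_nat ffact_le_expn.
have lower N : (N.*2.+1 ^_ j.*2.+1)%:R / N.*2.+1%:R ^+ j.*2.+1 * F <= elsym a N j.
  rewrite -elsym_cotsq; have [|//] := andP (@le_elsym _ (c N) a N j _).
  by move=> i iN; rewrite c0/=; have /andP[] := c_bounds N i iN.
have lim_a : elsym a N j @[N --> \oo] --> F.
  apply: (@squeeze_cvgr _ _ _ _ (fun N =>
     (N.*2.+1 ^_ j.*2.+1)%:R / N.*2.+1%:R ^+ j.*2.+1 * F) (fun=> F)).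
  - by apply: nearW => N; rewrite lower upper.
  - by rewrite -[X in _ --> X]mul1r; apply: cvgMl; exact: cvg_ffact_ratio.
  - exact: cvg_cst.
rewrite (_ : (fun N => _) = (fun N => pi ^+ (2 * j) * elsym a N j)); last first.
  apply/funext => N; rewrite elsymZ exprM mulrA -exprMn mulfV ?expf_neq0 ?gt_eqF//.
  by rewrite expr1n mul1r.
by rewrite mul2n; apply: cvgMr.
Unshelve. all: by end_near. Qed.
End Cotangents.

(** * The value of zeta(3,1,...,3,1) *)

Lemma zeta31_morph (K L : comNzRingType) (phi : {rmorphism K -> L}) q w N :
  zeta31 (phi q) (phi \o w) N = (phi (zeta31 q w N).1, phi (zeta31 q w N).2).
Proof.
elim: N => [|N IH]; first by rewrite /= rmorph1 rmorph0.
by rewrite !zeta31S IH/= !rmorphD !(rmorphXn, rmorphM).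
Qed.

Lemma coef_comp_scaleX2 (K : comNzRingType) (a : K) (p : {poly K}) n :
  (p \Po (a *: 'X^2))`_(2 * n) = a ^+ n * p`_n.
Proof.
rewrite comp_polyE coef_sum.
under eq_bigr do rewrite exprZn scalerA coefZ -exprM coefXn eqn_pmul2l//.
have [np|pn] := ltnP n (size p).
  rewrite (bigD1 (Ordinal np))//= eqxx mulr1 big1 ?addr0 1?mulrC// => i.
  by rewrite -val_eqE/= eq_sym => /negbTE ->; rewrite mulr0.
rewrite nth_default// mulr0 big1// => i _.
by rewrite (_ : (n == i) = false) ?mulr0//; apply/eqP; have := ltn_ord i; lia.
Qed.

(** Summing coefficients is multiplication by 1/(1-t); associativity moves it
    onto the second factor. *)
Lemma sum_fpsM (K : comNzRingType) (f g : fps K) N :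
  \sum_(m < N.+1) (f * g) m = \sum_(k < N.+1) f k * \sum_(l < (N - k).+1) g l.
Proof.
have sumE (h : fps K) n : \sum_(m < n.+1) h m = (h * fps_geom 1) n.
  by rewrite fpsM; apply: eq_bigr => i _; rewrite /fps_geom expr1n mulr1.
by rewrite sumE -mulrA fpsM; apply: eq_bigr => k _; rewrite sumE.
Qed.

(** The difference of the partial products with k and k-1 factors. *)
Definition eincr (K : comNzRingType) (u : nat -> K) k : {poly K} :=
  if k is l.+1 then (u l)%:P * 'X * eprod u l else 1.

Lemma sum_eincr (K : comNzRingType) (u : nat -> K) N :
  \sum_(k < N.+1) eincr u k = eprod u N.
Proof.
elim: N => [|N IH]; first by rewrite big_ord1 /eprod big_ord0.
by rewrite big_ord_recr/= IH /eprod big_ord_recr/=; ring.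
Qed.

Section Domination.
Variable R : realFieldType.
Implicit Types p q r : {poly R}.

Definition coef_ge0 p := forall j, 0 <= p`_j.

Lemma coef_ge0M p q : coef_ge0 p -> coef_ge0 q -> coef_ge0 (p * q).
Proof. by move=> p0 q0 j; rewrite coefM sumr_ge0// => i _; rewrite mulr_ge0. Qed.

Lemma coef_ge0_sum (I : Type) (s : seq I) (A : pred I) (F : I -> {poly R}) :
  (forall i, A i -> coef_ge0 (F i)) -> coef_ge0 (\sum_(i <- s | A i) F i).
Proof. by move=> F0 j; rewrite coef_sum sumr_ge0// => i /F0. Qed.

Lemma coefM_dominated p q r j :
  (forall i, `|p`_i| <= q`_i) -> coef_ge0 r ->
  `|(p * r)`_j| <= (q * r)`_j.
Proof.
move=> pq r0; rewrite !coefM; apply: le_trans (ler_norm_sum _ _ _) _.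
apply: ler_sum => i _; rewrite normrM (ger0_norm (r0 _)).
by apply: ler_wpM2r (pq _); exact: r0.
Qed.

Variable u : nat -> R.
Hypothesis u0 : forall i, 0 <= u i.

Let Q N := eprod u N.
Let P N := eprod (fun i => - u i) N.

Let g := eincr u.
Let f := eincr (fun i => - u i).

Lemma eprod_ge0 N : coef_ge0 (Q N).
Proof. by move=> j; exact: elsym_ge0. Qed.

Lemma eprod_mono M N : (M <= N)%N -> coef_ge0 (Q N - Q M).
Proof.
move=> MN j; rewrite coefB subr_ge0.
exact: elsym_homo.
Qed.

Lemma eincr_ge0 k : coef_ge0 (g k).
Proof.
case: k => [|k] j /=; first by rewrite coef1.
rewrite -mulrA coefCM coefXM mulr_ge0//; case: j => // j; exact: eprod_ge0.
Qed.

Lemma eincr_dominated k i : `|(f k)`_i| <= (g k)`_i.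
Proof.
case: k => [|k] /=; first by rewrite /f /g/= coef1 ger0_norm.
rewrite /g /f/= -!mulrA !coefCM !coefXM normrM normrN (ger0_norm (u0 k)).
apply: ler_wpM2l => //; case: i => [|i] /=; first by rewrite normr0.
rewrite -/(elsym _ _ _) -/(elsym _ _ _).
rewrite (_ : (fun i => - u i) = (fun i => -1 * u i)); last first.
  by apply/funext => l; rewrite mulN1r.
rewrite elsymZ normrM normrX normrN1 expr1n mul1r ger0_norm//.
exact: elsym_ge0.
Qed.

(** Without truncation the sum over k would factor as P Q.  The error is a sum of
    products of increments with indices k + l > N.  Those of P are dominated by
    those of Q, and for the latter the pairs k, l <= M with 2 M <= N are not in
    the error, so it is at most Q_N^2 - Q_M^2. *)
Lemma cauchy_truncation M N j : (M.*2 <= N)%N ->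
  `|(P N * Q N - \sum_(k < N.+1) f k * Q (N - k)%N)`_j|
    <= (Q N ^+ 2 - Q M ^+ 2)`_j.
Proof.
move=> MN; have sumQ n : \sum_(k < n.+1) g k = Q n by exact: sum_eincr.
rewrite -[P N](sum_eincr (fun i => - u i)) mulr_suml -sumrB coef_sum.
apply: le_trans (ler_norm_sum _ _ _) _.
apply: (@le_trans _ _ (\sum_(k < N.+1) (g k * (Q N - Q (N - k)%N))`_j)).
  apply: ler_sum => k _; rewrite -mulrBr; apply: coefM_dominated.
    exact: eincr_dominated.
  by apply: eprod_mono; rewrite leq_subr.
rewrite -coef_sum -subr_ge0 -coefB.
have -> : Q N ^+ 2 - Q M ^+ 2 - \sum_(k < N.+1) g k * (Q N - Q (N - k)%N) =
    \sum_(k < N.+1) g k * Q (N - k)%N - Q M ^+ 2.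
  under eq_bigr do rewrite mulrBr; rewrite sumrB -mulr_suml sumQ; ring.
have -> : \sum_(k < N.+1) g k * Q (N - k)%N - Q M ^+ 2 =
   \sum_(k < M.+1) g k * (Q (N - k)%N - Q M) +
   \sum_(M.+1 <= k < N.+1) g k * Q (N - k)%N.
  rewrite -(big_mkord xpredT (fun k => g k * Q (N - k)%N)).
  rewrite (big_cat_nat (n := M.+1))//=; last by lia.
  rewrite big_mkord; under [in RHS]eq_bigr do rewrite mulrBr.
  by rewrite sumrB -mulr_suml sumQ; ring.
rewrite coefD addr_ge0//; apply: coef_ge0_sum => k _; apply: coef_ge0M;
  rewrite ?eincr_ge0 ?eprod_ge0//.
- exact: eincr_ge0.
- by apply: eprod_mono; have := ltn_ord k; lia.
- exact: eincr_ge0.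
- exact: eprod_ge0.
Qed.

End Domination.

Lemma cvg_half : (N./2) @[N --> \oo] --> \oo.
Proof.
apply/cvgnyPge => A; near=> N; have : (A.*2 <= N)%N by near: N; exact: nbhs_infty_ge.
lia.
Unshelve. all: by end_near. Qed.

Section ZetaThreeOne.
Variable R : realType.

Definition invn i : R := i.+1%:R^-1.

Lemma invn_sq i : invn i ^+ 2 = inv_sq R i. Proof. exact: exprVn. Qed.

Definition zeta31_poly N : {poly R} := (zeta31 'X (polyC \o invn) N).1.

(** The substitution q = - 4 X^2 turns the recurrence into the hypergeometric
    product with c = X. *)
Lemma zeta31_poly_coef N n :
  (-4) ^+ n * (zeta31_poly N)`_n =
  (\sum_(k < N.+1) eincr (fun i => - inv_sq R i) k *
     eprod (inv_sq R) (N - k)%N)`_(2 * n).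
Proof.
have wE k : k.+1%:R * (polyC \o invn) k = 1 :> {poly R}.
  by rewrite /= -polyC_natr -polyCM mulfV ?pnatr_eq0.
have hE s N' : hprod (polyC \o invn) (s%:P * 'X) N' =
    eprod (fun i => - s * inv_sq R i) N'.
  rewrite /hprod /eprod; apply: eq_bigr => i _.
  by rewrite -invn_sq !(polyCM, polyCN, polyC_exp)/=; ring.
have iE s k : hyper (polyC \o invn) (s%:P * 'X) k =
    eincr (fun i => - s * inv_sq R i) k.
  case: k => [|k] //=; rewrite hE -invn_sq !(polyCM, polyCN, polyC_exp)/=; ring.
rewrite -coef_comp_scaleX2.
have -> : zeta31_poly N \Po (-4 *: 'X^2) =
    (zeta31 (- 4 * 'X ^+ 2) (polyC \o invn) N).1.
  have := zeta31_morph (comp_poly (- 4 *: 'X^2) : {rmorphism {poly R} -> {poly R}})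
     'X (polyC \o invn) N.
  rewrite /= comp_polyX => /(congr1 fst)/= <-; congr (zeta31 _ _ _).1.
    by rewrite -mul_polyC polyCN polyC_natr.
  by apply/funext => i /=; rewrite comp_polyC.
rewrite (zeta31_hyper wE) sum_fpsM; congr (_`_ _).
have fE k : hyper (polyC \o invn) 'X k = eincr (fun i => - inv_sq R i) k.
  rewrite -['X]mul1r -polyC1 iE; congr eincr.
  by apply/funext => i; rewrite mulN1r.
have gE k : hyper (polyC \o invn) (- 'X) k = eincr (inv_sq R) k.
  rewrite -['X]mul1r -mulNr -polyC1 -polyCN iE; congr eincr.
  by apply/funext => i; rewrite opprK mul1r.
rewrite (eq_bigr (fun k : 'I_N.+1 => eincr (fun i => - inv_sq R i) k *
  eprod (inv_sq R) (N - k)%N)) => // k _.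
rewrite fE -sum_eincr; congr (_ * _); apply: eq_bigr => l _; exact: gE.
Qed.

Lemma cvg_coefM (p_ q_ : nat -> {poly R}) (a b : nat -> R) j :
  (forall i, (p_ N)`_i @[N --> \oo] --> a i) ->
  (forall i, (q_ N)`_i @[N --> \oo] --> b i) ->
  (p_ N * q_ N)`_j @[N --> \oo] --> \sum_(i < j.+1) a i * b (j - i)%N.
Proof.
move=> pa qb.
rewrite (_ : (fun N => _) = (fun N => \sum_(i < j.+1) (p_ N)`_i * (q_ N)`_(j - i)%N)).
  apply: cvg_big => [|i _]; first exact: add_continuous.
  by apply: cvgM; [exact: pa|exact: qb].
by apply/funext => N; rewrite coefM.
Qed.

(** By [cauchy_truncation] the coefficient has the same limit as that of the full
    product of (1 - X/k^2) and (1 + X/k^2), which Euler's product expresses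
    through sin y sinh y. *)
Lemma cvg_zeta31_poly n :
  (zeta31_poly N)`_n @[N --> \oo] --> 2 * pi ^+ (4 * n) / (4 * n + 2)`!%:R.
Proof.
pose Q N := eprod (inv_sq R) N; pose P N := eprod (fun i => - inv_sq R i) N.
pose l i : R := pi ^+ (2 * i) / (2 * i).+1`!%:R.
have u0 i : 0 <= inv_sq R i by rewrite invr_ge0 exprn_ge0.
have cQ i : (Q N)`_i @[N --> \oo] --> l i by exact: cvg_elsym_inv_sq.
have cP i : (P N)`_i @[N --> \oo] --> (-1) ^+ i * l i.
  rewrite (_ : (fun N => _) = (fun N => (-1) ^+ i * (Q N)`_i)); last first.
    apply/funext => N; rewrite -[RHS]elsymZ /P; congr (_`_i); congr eprod.
    by apply/funext => k; rewrite mulN1r.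
  by apply: cvgMr.
pose T N := (\sum_(k < N.+1) eincr (fun i => - inv_sq R i) k * Q (N - k)%N)`_(2 * n).
have cT : T N @[N --> \oo] -->
    \sum_(i < (2 * n).+1) ((-1) ^+ i * l i) * l (2 * n - i)%N.
  have cPQ := cvg_coefM (j := (2 * n)%N) cP cQ.
  have d0 : (Q N ^+ 2 - Q N./2 ^+ 2)`_(2 * n) @[N --> \oo] --> (0 : R).
    have cQQ := cvg_coefM (j := (2 * n)%N) cQ cQ.
    rewrite -[X in _ --> X](subrr (\sum_(i < (2 * n).+1) l i * l (2 * n - i)%N)).
    have -> : (fun N => (Q N ^+ 2 - Q N./2 ^+ 2)`_(2 * n)) =
        (fun N => (Q N * Q N)`_(2 * n) - (Q N./2 * Q N./2)`_(2 * n)).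
      by apply/funext => N; rewrite coefB !expr2.
    apply: cvgB; first exact: cQQ.
    exact: (@cvg_comp _ _ _ (fun N => N./2) (fun N => (Q N * Q N)`_(2 * n))
      _ _ _ cvg_half cQQ).
  have : (P N * Q N)`_(2 * n) - T N @[N --> \oo] --> (0 : R).
    apply: norm_cvg0; apply: (@squeeze_cvgr _ _ _ _ (fun=> 0) _ _ _ _ _ d0); last exact: cvg_cst.
    apply: nearW => N; rewrite normr_ge0/= -coefB; apply: cauchy_truncation => //.
    lia.
  move=> /(cvgB cPQ); rewrite subr0; apply: cvg_trans.
  by apply: near_eq_cvg; apply: nearW => N /=; rewrite opprB addrC subrK.
have -> : (fun N => (zeta31_poly N)`_n) = (fun N => (-4) ^- n * T N).
  apply/funext => N; rewrite /T -zeta31_poly_coef mulKf// expf_neq0//; lra.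
have -> : 2 * pi ^+ (4 * n) / (4 * n + 2)`!%:R =
    (-4) ^- n * \sum_(i < (2 * n).+1) ((-1) ^+ i * l i) * l (2 * n - i)%N :> R.
  have -> : \sum_(i < (2 * n).+1) ((-1) ^+ i * l i) * l (2 * n - i)%N =
     pi ^+ (4 * n) * (2 * (-4) ^+ n / (4 * n + 2)`!%:R).
    rewrite -sum_alternating_inv_fact mulr_sumr; apply: eq_bigr => i _.
    rewrite (_ : (4 * n = 2 * i + 2 * (2 * n - i))%N).
      by rewrite exprD /l; ring.
    by have := ltn_ord i; lia.
  have x0 : (-4) ^+ n != 0 :> R by rewrite expf_neq0//; lra.
  have y0 : ((4 * n + 2)`!)%:R != 0 :> R by rewrite pnatr_eq0 -lt0n fact_gt0.
  have aux (p x F : R) : x != 0 -> F != 0 -> 2 * p / F = x^-1 * (p * (2 * x / F)).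
    by move=> x1 F1; field; rewrite ?x1 ?F1.
  exact: aux.
by apply: cvgMr.
Qed.
End ZetaThreeOne.

(** * The zeta-star series as a limit of truncated sums *)

Section TruncatedStar.
Variable R : realType.

(** The truncation m_1 <= N of the zeta-star series, by recursion on its largest
    index. *)
Fixpoint star_sum (k : seq nat) (N : nat) : R :=
  if k is a :: s then \sum_(m < N) m.+1%:R ^- a * star_sum s m.+1 else 1.

Lemma star_sum_ge0 k N : 0 <= star_sum k N.
Proof.
elim: k N => [|a s IH] N //=; apply: sumr_ge0 => m _.
by rewrite mulr_ge0// invr_ge0 exprn_ge0.
Qed.

Definition star_term k (t : (size k).-tuple nat) : R :=
  \prod_(i < size k) ((tnth t i)%:R ^+ nth 0%N k i)^-1.

Definition star_chain (k : seq nat) N : set ((size k).-tuple nat) :=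
  [set t | path geq N t && all (ltn 0%N) t].
Arguments star_chain : clear implicits.

Lemma star_term_cons a (s : seq nat) m (t : (size s).-tuple nat) :
  star_term (k := a :: s) [tuple of m :: t] = m%:R ^- a * star_term t.
Proof.
rewrite /star_term big_ord_recl/= tnth0; congr (_ * _).
by apply: eq_bigr => i _; rewrite tnthS.
Qed.

Lemma star_term_ge0 k (t : (size k).-tuple nat) : 0 <= star_term t.
Proof. by apply: prodr_ge0 => i _; rewrite invr_ge0 exprn_ge0. Qed.

(** Fubini on the first index, shifted by one so that it is positive.  The set [I]
    covers both the truncated series and the full one; the factor [c] absorbs the
    powers of the indices already split off. *)
Lemma esum_star_cons a (s : seq nat) (I : set nat) (c : R) : 0 <= c ->
  (forall m (d : R), 0 <= d ->
     \esum_(t in star_chain s m) (d * star_term t)%:E = (d * star_sum s m)%:E) ->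
  \esum_(t in [set t : (size (a :: s)).-tuple nat |
      I (thead t).-1 /\ sorted geq t && all (ltn 0%N) t])
    (c * star_term t)%:E =
  \esum_(m in I) (c * (m.+1%:R ^- a * star_sum s m.+1))%:E.
Proof.
move=> c0 IH.
have w0 m : 0 <= m.+1%:R ^- a :> R by rewrite invr_ge0 exprn_ge0.
pose e (x : nat * (size s).-tuple nat) : (size (a :: s)).-tuple nat :=
  [tuple of x.1.+1 :: x.2].
rewrite (reindex_esum (I `*`` (fun m => star_chain s m.+1)) _ e); last first.
  split.
  - move=> [m t] /= [Im /andP[pt t0]]; split; first exact: Im.
    by rewrite /= pt t0.
  - move=> [m t] [m' t'] _ _ /(congr1 val)/= [-> tt']; congr pair.
    exact: val_inj.
  - move=> t; case/tupleP: t => -[|m] t /= [].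
      by move=> _ /andP[_]/=.
    by move=> Im pt; exists (m, t).
transitivity (\esum_(m in I) \esum_(t in star_chain s m.+1)
    (c * (m.+1%:R ^- a * star_term t))%:E).
  rewrite esum_esum//; first by apply: eq_esum => -[m t] _; rewrite /= star_term_cons.
  by move=> m t _ _; rewrite lee_fin mulr_ge0// mulr_ge0// star_term_ge0.
apply: eq_esum => m _; under eq_esum do rewrite mulrA.
by rewrite IH ?mulrA// mulr_ge0.
Qed.

Lemma esum_star_chain (k : seq nat) N (c : R) : 0 <= c ->
  \esum_(t in star_chain k N) (c * star_term t)%:E = (c * star_sum k N)%:E.
Proof.
elim: k N c => [|a s IH] N c c0.
  have -> : star_chain [::] N = [set [tuple] : (size (@nil nat)).-tuple nat].
    by apply/seteqP; split=> [t _|_ ->//]; exact: tuple0.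
  by rewrite esum_set1 /star_term big_ord0 ?lee_fin ?mulr1.
transitivity (\esum_(m in `I_N) (c * (m.+1%:R ^- a * star_sum s m.+1))%:E).
  rewrite -esum_star_cons//; congr esum; apply/seteqP; split => t.
    case/tupleP: t => -[|m] t /=; first by move=> /andP[_ /andP[]].
    move=> /andP[/andP[iN pt] t0]; split; first exact: iN.
    by apply/andP; split.
  case/tupleP: t => -[|m] t /= []; first by move=> _ /andP[_]/=.
  move=> iN /andP[pt t0]; apply/andP; split=> //.
  by apply/andP; split; [exact: iN|exact: pt].
have f0 m : 0 <= c * (m.+1%:R ^- a * star_sum s m.+1).
  by rewrite mulr_ge0// mulr_ge0 ?star_sum_ge0// invr_ge0 exprn_ge0.
rewrite esum_fset//; last by move=> m _; rewrite lee_fin.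
by rewrite -fsbig_ord sumEFin mulr_sumr.
Qed.

Lemma zeta_star_lim a (s : seq nat) (l : R) :
  star_sum (a :: s) N @[N --> \oo] --> l -> zeta_star R (a :: s) = l%:E.
Proof.
move=> cl; rewrite /zeta_star.
transitivity (\esum_(m in [set: nat]) (1 * (m.+1%:R ^- a * star_sum s m.+1))%:E : \bar R).
  rewrite -esum_star_cons//; last by move=> m d; exact: esum_star_chain.
  rewrite (_ : [set m : (size (a :: s)).-tuple nat | _] =
    [set t | [set: nat] (thead t).-1 /\ sorted geq t && all (ltn 0%N) t]).
    by apply: eq_esum => t _; rewrite mul1r.
  by apply/seteqP; split => t //= [].
rewrite -nneseries_esumT; last first.
  by move=> m; rewrite mul1r lee_fin mulr_ge0 ?star_sum_ge0// invr_ge0 exprn_ge0.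
have cE : (EFin \o star_sum (a :: s)) @ \oo --> l%:E.
  by apply: cvg_EFin; [exact: nearW|exact: cl].
apply: cvg_lim => //; apply: cvg_trans cE.
apply: near_eq_cvg; apply: nearW => N /=.
by rewrite big_mkord sumEFin; congr EFin; apply: eq_bigr => m _; rewrite mul1r.
Qed.

End TruncatedStar.

(** * Formal inverses and the series of t / sinh t *)

Lemma sum_even (V : nmodType) (F : nat -> V) n :
  (forall i, F (2 * i).+1 = 0) ->
  \sum_(i < (2 * n).+1) F i = \sum_(i < n.+1) F (2 * i)%N.
Proof.
move=> F0; elim: n => [|n IH]; first by rewrite !big_ord1.
rewrite [RHS]big_ord_recr/= -IH (_ : 2 * n.+1 = (2 * n).+2)%N; last by lia.
by rewrite big_ord_recr/= big_ord_recr/= F0 addr0.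
Qed.

Section FormalInverse.
Variable K : comNzRingType.

Lemma fps_expr_order (u : fps K) k n : u 0%N = 0 -> (n < k)%N -> (u ^+ k) n = 0.
Proof.
move=> u0; elim: k n => // k IH n nk; rewrite exprS fpsM big1// => -[[|i] iP] _ /=.
  by rewrite u0 mul0r.
by rewrite IH ?mulr0//; lia.
Qed.

(** The inverse is the geometric series in 1 - f, whose k-th term starts at
    degree k. *)
Lemma fps_inv_ex (f : fps K) : f 0%N = 1 -> exists g : fps K, f * g = 1.
Proof.
move=> f0; pose u := 1 - f.
have u0 : u 0%N = 0 by rewrite /u fpsB fps1 f0 subrr.
have sumE (s : nat -> fps K) m n : (\sum_(k < m) s k) n = \sum_(k < m) s k n.
  by elim: m => [|m IH]; rewrite ?big_ord0// !big_ord_recr/= fpsD IH.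
pose g : fps K := fun n => (\sum_(k < n.+1) u ^+ k) n.
exists g; apply/funext => n.
have gE i : (i <= n)%N -> g i = (\sum_(k < n.+1) u ^+ k) i.
  move=> iN; rewrite /g !sumE (big_ord_widen n.+1 (fun k => (u ^+ k) i))//.
  rewrite big_mkcond/=; apply: eq_bigr => k _; case: ltnP => // ik.
  by rewrite fps_expr_order.
transitivity ((f * \sum_(k < n.+1) u ^+ k) n).
  by rewrite !fpsM; apply: eq_bigr => i _; rewrite gE// leq_subr.
have -> : f = 1 - u by rewrite /u opprB addrC subrK.
have := subrXX 1 u n.+1; rewrite expr1n => E.
rewrite (eq_bigr (fun i : 'I_n.+1 => 1 ^+ (n.+1.-1 - i) * u ^+ i)); last first.
  by move=> i _; rewrite expr1n mul1r.
by rewrite -E fpsB fps_expr_order// subr0.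
Qed.

End FormalInverse.

Section FormalExponential.
Variable R : numFieldType.
Implicit Types f g : fps R.

Definition fps_exp (a : R) : fps R := fun n => a ^+ n / n`!%:R.
Definition fps_dilate (a : R) f : fps R := fun n => a ^+ n * f n.
(** (e^t - 1) / t *)
Definition fps_expquot : fps R := fun n => (n.+1)`!%:R^-1.
(** (sinh t) / t *)
Definition fps_sinhc : fps R := fun n => if odd n then 0 else (n.+1)`!%:R^-1.

Lemma fact_neq0 n : n`!%:R != 0 :> R.
Proof. by rewrite pnatr_eq0 -lt0n fact_gt0. Qed.

Lemma fps_dilateM a f g : fps_dilate a (f * g) = fps_dilate a f * fps_dilate a g.
Proof.
apply/funext => n; rewrite /fps_dilate !fpsM mulr_sumr; apply: eq_bigr => i _.
have iN : (i <= n)%N by rewrite -ltnS.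
by rewrite -{1}(subnKC iN) exprD; ring.
Qed.

Lemma fps_dilate1 a : fps_dilate a 1 = 1.
Proof.
apply/funext => n; rewrite /fps_dilate !fps1.
by case: n => [|n]; rewrite ?mulr0// expr0 mul1r.
Qed.

Lemma fps_expD a b : fps_exp a * fps_exp b = fps_exp (a + b).
Proof.
apply/funext => n; rewrite fpsM /fps_exp addrC exprDn mulr_suml.
apply: eq_bigr => i _; have iN : (i <= n)%N by rewrite -ltnS.
rewrite -(bin_fact iN) !natrM -mulr_natr.
have := fact_neq0 i; have := fact_neq0 (n - i).
have : 'C(n, i)%:R != 0 :> R by rewrite pnatr_eq0 -lt0n bin_gt0.
by move=> x0 y0 z0; field; rewrite x0 y0 z0.
Qed.

Lemma fps_exp0 : fps_exp 0 = 1.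
Proof.
apply/funext => n; rewrite /fps_exp fps1 expr0n.
by case: n => [|n]; rewrite ?mul0r// divr1.
Qed.

Lemma fpsX_inj f g : fpsX R * f = fpsX R * g -> f = g.
Proof.
move=> fg; apply/funext => n.
by have := congr1 (fun h : fps R => h n.+1) fg; rewrite !fpsXM.
Qed.

Lemma fpsX_expquot : fpsX R * fps_expquot = fps_exp 1 - 1.
Proof.
apply/funext => n; rewrite fpsXM fpsB fps1 /fps_exp expr1n mul1r.
by case: n => [|n]; rewrite ?subr0// invr1 subrr.
Qed.

Lemma fpsX_expquot2 :
  2 * fpsX R * fps_dilate 2 fps_expquot = fps_exp 1 ^+ 2 - 1.
Proof.
rewrite expr2 fps_expD; apply/funext => n.
rewrite -mulrA (_ : 2 = fpsC 2); last by rewrite rmorph_nat.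
rewrite fpsCM fpsXM fpsB fps1 /fps_exp.
case: n => [|n]; first by rewrite expr0 divr1 subrr mulr0.
by rewrite /fps_dilate subr0 exprS mulrA.
Qed.

Lemma fpsX_sinhc : 2 * fpsX R * fps_sinhc = fps_exp 1 - fps_exp (-1).
Proof.
apply/funext => n.
rewrite -mulrA (_ : 2 = fpsC 2); last by rewrite rmorph_nat.
rewrite fpsCM fpsXM fpsB /fps_exp -signr_odd expr1n.
case: n => [|n]/=; first by rewrite expr0 subrr mulr0.
by rewrite /fps_sinhc; case: odd => /=; rewrite ?expr0 ?expr1; ring.
Qed.

(** For b(t) = t/(e^t - 1), 2 b(t) - b(2t) = t/sinh t.  Both sides are
    multiplied by e^t, which is invertible, to stay within power series. *)
Lemma bernoulli_sinhc (b : fps R) : b * fps_expquot = 1 ->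
  (2 * b - fps_dilate 2 b) * fps_sinhc = 1.
Proof.
move=> bE.
set e := fps_exp 1; set e' := fps_exp (-1).
have ee' : e * e' = 1 by rewrite fps_expD subrr fps_exp0.
have dbE : fps_dilate 2 b * fps_dilate 2 fps_expquot = 1.
  by rewrite -fps_dilateM bE fps_dilate1.
have dE : 2 * fps_dilate 2 fps_expquot = fps_expquot * (e + 1).
  apply: fpsX_inj; rewrite mulrA [_ * 2]mulrC fpsX_expquot2 mulrA fpsX_expquot.
  by rewrite -/e; ring.
have eS : e * fps_sinhc = fps_dilate 2 fps_expquot.
  have two_inj f g : 2 * f = 2 * g -> f = g.
    rewrite (_ : 2 = fpsC 2); last by rewrite rmorph_nat.
    move=> fg; apply/funext => n; have := congr1 (fun h : fps R => h n) fg.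
    by rewrite !fpsCM => /mulfI; apply; rewrite pnatr_eq0.
  apply: two_inj; apply: fpsX_inj.
  transitivity (e * (2 * fpsX R * fps_sinhc)); first by ring.
  rewrite fpsX_sinhc -/e -/e' mulrBr ee' -expr2 -fpsX_expquot2; ring.
transitivity ((2 * b - fps_dilate 2 b) * fps_sinhc * (e * e')).
  by rewrite ee' [RHS]mulr1.
transitivity (e' * (b * (2 * fps_dilate 2 fps_expquot)
   - fps_dilate 2 b * fps_dilate 2 fps_expquot)).
  by rewrite -eS; ring.
rewrite dE dbE mulrA bE -[RHS]ee'; ring.
Qed.

(** Only even degrees are compared, so that the odd Bernoulli numbers never
    occur. *)
Lemma bernoulli_even_sinhc (b : fps R) n : b * fps_expquot = 1 ->
  \sum_(i < n.+1) ((2 * i).+1)`!%:R^-1 *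
    ((2 - 2 ^+ (2 * (n - i))) * b (2 * (n - i))%N) = (n == 0%N)%:R.
Proof.
move=> /bernoulli_sinhc; rewrite mulrC => H.
have := congr1 (fun h : fps R => h (2 * n)%N) H.
rewrite fps1 muln_eq0/= fpsM (sum_even (F := fun i => fps_sinhc i *
  (2 * b - fps_dilate 2 b) (2 * n - i)%N)) => [<-|i].
  apply: eq_bigr => i _; rewrite /fps_sinhc mul2n odd_double -mul2n.
  rewrite mulnBr fpsB (_ : 2 = fpsC 2 :> fps R); last by rewrite rmorph_nat.
  by rewrite fpsCM /fps_dilate mulrBl.
by rewrite /fps_sinhc /= mul2n odd_double mul0r.
Qed.

End FormalExponential.

(** * Bernoulli numbers as a formal inverse *)

Section AnalyticBernoulli.
Variable R : realType.

(** By induction, the recurrence bounds |b_n| by the sum of the 1/(i+1)! over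
    i >= 1, and that sum by 1/2 + 1/4 + ... <= 1. *)
Lemma fps_expquot_inv_bounded (b : fps R) n :
  b * fps_expquot R = 1 -> `|b n| <= 1.
Proof.
rewrite mulrC => Eb; elim/ltn_ind: n => -[_|n IH].
  have := congr1 (fun h : fps R => h 0%N) Eb.
  by rewrite fpsM big_ord1 fps1 /fps_expquot invr1 mul1r => ->; rewrite normr1.
have := congr1 (fun h : fps R => h n.+1) Eb.
rewrite fpsM fps1 big_ord_recl/= subn0 {1}/fps_expquot invr1 mul1r.
move/eqP; rewrite addr_eq0 => /eqP ->; rewrite normrN.
apply: le_trans (ler_norm_sum _ _ _) _.
have term (i : nat) : (i < n.+1)%N ->
    `|fps_expquot R i.+1 * b (n.+1 - i.+1)%N| <= 2^-1 ^+ i - 2^-1 ^+ i.+1.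
  move=> iN; rewrite normrM.
  have -> : 2^-1 ^+ i - 2^-1 ^+ i.+1 = 2^-1 ^+ i.+1 * 1 :> R.
    by rewrite exprS; field.
  apply: ler_pM => //; last by apply: IH; lia.
  rewrite /fps_expquot ger0_norm// exprVn lef_pV2 ?posrE ?exprn_gt0 ?ltr0n ?fact_gt0//.
  rewrite -natrX ler_nat; elim: i {iN} => [|i IHi] //.
  by rewrite expnS factS leq_mul.
apply: (@le_trans _ _ (\sum_(i < n.+1) (2^-1 ^+ i - 2^-1 ^+ i.+1))).
  by apply: ler_sum => i _; apply: term.
rewrite -(big_mkord xpredT (fun i => 2^-1 ^+ i - 2^-1 ^+ i.+1)).
rewrite (telescope_sumr_eq (fun i => - 2^-1 ^+ i))//; last first.
  by move=> k _; rewrite opprK addrC.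
by rewrite opprK expr0 addrC gerBl exprn_ge0.
Qed.

Lemma cvg_expquot (t : R) : t != 0 ->
  \sum_(i < N.+1) fps_expquot R i * t ^+ i @[N --> \oo] --> (expR t - 1) / t.
Proof.
move=> t0.
have cE : series (exp_coeff t) N.+2 @[N --> \oo] --> expR t.
  rewrite (cvg_shiftS (fun n => series (exp_coeff t) n.+1)).
  rewrite (cvg_shiftS (series (exp_coeff t))).
  exact: is_cvg_series_exp_coeff.
have -> : (fun N => \sum_(i < N.+1) fps_expquot R i * t ^+ i) =
    (fun N => (series (exp_coeff t) N.+2 - 1) / t).
  apply/funext => N; rewrite /series/= big_mkord big_ord_recl/= /exp_coeff/=.
  rewrite expr0 fact0 divr1 addrC addKr mulr_suml; apply: eq_bigr => i _.
  rewrite /bump/= add1n exprS /fps_expquot.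
  by rewrite [RHS]mulrAC [t * _]mulrC mulfK// mulrC.
by apply: cvgM; [apply: cvgB => //; exact: cvg_cst|exact: cvg_cst].
Qed.

(** The product of the two partial sums differs from 1 by at most (N+1)^2 terms of
    size at most |t|^N.  The radius 1/8 makes this at most 2^-N, because
    (N+1)^2 <= 4^N. *)
Lemma cvg_bernoulli_series (b : fps R) (t : R) :
  b * fps_expquot R = 1 -> (forall n, `|b n| <= 1) -> 0 < `|t| <= 8^-1 ->
  pseries b t @ \oo --> t / (expR t - 1).
Proof.
move=> bE b1 /andP[t0 t8].
have tn0 : t != 0 by rewrite -normr_gt0.
have et0 : expR t - 1 != 0.
  rewrite subr_eq0; apply/negP => /eqP; rewrite -expR0 => /expR_inj t00.
  by rewrite t00 eqxx in tn0.
pose B : fps R := fps_dilate t b.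
pose E : fps R := fps_dilate t (fps_expquot R).
pose S n := \sum_(i < n.+1) E i.
pose T n := \sum_(i < n.+1) B i.
have BE : B * E = 1 by rewrite -fps_dilateM bE fps_dilate1.
have E1 n : `|fps_expquot R n| <= 1.
  by rewrite /fps_expquot ger0_norm// invf_le1 ?ltr0n ?fact_gt0// ler1n fact_gt0.
have Bt n : `|B n| <= `|t| ^+ n.
  by rewrite normrM normrX ler_piMr.
have Et n : `|E n| <= `|t| ^+ n.
  by rewrite normrM normrX ler_piMr.
have TS N : `|T N * S N - 1| <= (2^-1) ^+ N.
  have sum1 : \sum_(k < N.+1) B k * S (N - k)%N = 1.
    rewrite -sum_fpsM BE big_ord_recl fps1/= big1 ?addr0// => i _.
    by rewrite fps1.
  rewrite -[X in `|_ - X|]sum1 mulr_suml -sumrB; apply: le_trans (ler_norm_sum _ _ _) _.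
  apply: (@le_trans _ _ (\sum_(k < N.+1) N.+1%:R * `|t| ^+ N)).
    apply: ler_sum => k _; rewrite -mulrBr.
    have -> : S N - S (N - k)%N = \sum_(i < N.+1 | (N - k < i)%N) E i.
      rewrite /S (bigID (fun i : 'I_N.+1 => (i <= N - k)%N))/=.
      rewrite (big_ord_widen_cond N.+1 xpredT E); last by rewrite ltnS leq_subr.
      rewrite addrC addrK; apply: eq_bigl => i; by rewrite -ltnNge.
    rewrite mulr_sumr; apply: le_trans (ler_norm_sum _ _ _) _.
    rewrite big_mkcond/=.
    apply: (@le_trans _ _ (\sum_(i < N.+1) `|t| ^+ N)); last first.
      by rewrite sumr_const card_ord mulr_natl.
    apply: ler_sum => i _; case: ifPn => [ik|_]; last exact: exprn_ge0.
    rewrite normrM; apply: (@le_trans _ _ (`|t| ^+ k * `|t| ^+ i)).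
      exact: ler_pM.
    rewrite -exprD ler_wiXn2l//; last by have := ltn_ord k; lia.
    lra.
  rewrite sumr_const card_ord -[leLHS]mulr_natl mulrA.
  apply: (@le_trans _ _ (4 ^+ N * 8^-1 ^+ N)).
    apply: ler_pM; rewrite ?mulr_ge0 ?exprn_ge0//; last first.
      by rewrite lerXn2r ?nnegrE.
    rewrite -natrX -natrM ler_nat (_ : 4 = 2 * 2)%N// expnMn.
    by apply: leq_mul; apply: ltn_expl.
  have E48 : 4 * 8^-1 = 2^-1 :> R by field.
  by rewrite -exprMn E48.
have cS : S N @[N --> \oo] --> (expR t - 1) / t.
  rewrite (_ : S = (fun N => \sum_(i < N.+1) fps_expquot R i * t ^+ i)).
    exact: cvg_expquot.
  by apply/funext => N; apply: eq_bigr => i _; rewrite mulrC.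
have cTS : T N * S N @[N --> \oo] --> (1 : R).
  have : T N * S N - 1 @[N --> \oo] --> (0 : R).
    apply: norm_cvg0; apply: (@squeeze_cvgr _ _ _ _ (fun=> 0) (fun N => 2^-1 ^+ N)).
    - by apply: nearW => N; rewrite normr_ge0/=.
    - exact: cvg_cst.
    - by apply: cvg_expr; rewrite ger0_norm// invf_lt1// ltr1n.
  move=> /(cvgD (cvg_cst (1 : R))); rewrite addr0; apply: cvg_trans.
  by apply: near_eq_cvg; apply: nearW => N /=; rewrite addrC subrK.
have S0 : (expR t - 1) / t != 0 by rewrite mulf_neq0// invr_eq0.
have cT : T N @[N --> \oo] --> t / (expR t - 1).
  have cI : T N * S N * (S N)^-1 @[N --> \oo] --> t / (expR t - 1).
    by rewrite -[X in _ --> X]mul1r -[t / _]invf_div; exact: (cvgM cTS (cvgV S0 cS)).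
  apply: cvg_trans cI.
  have nS : \forall N \near \oo, S N != 0 by exact: cvgr_neq0 cS S0.
  by apply: near_eq_cvg; apply: filterS nS => N SN; rewrite /= mulfK.
rewrite -(cvg_shiftS (pseries b t)); apply: cvg_trans cT; apply: near_eq_cvg.
apply: nearW => N; rewrite /pseries /series/= big_mkord.
by apply: eq_bigr => i _; rewrite mulrC.
Unshelve. all: by end_near. Qed.

(** If d_j is the first nonzero coefficient, the tail at t = t0 s is O(s^(j+1))
    while the leading term is of order s^j. *)
Lemma pseries_eq0 (d : nat -> R) (r : R) : 0 < r ->
  (forall t, 0 < `|t| < r -> pseries d t @ \oo --> (0 : R)) ->
  forall j, d j = 0.
Proof.
move=> r0 d0; elim/ltn_ind => j IH.
pose t0 := r / 2; have t00 : 0 < t0 by rewrite divr_gt0.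
have t0r : t0 < r by rewrite /t0; lra.
have [M Mb] : exists M, forall i, `|d i * t0 ^+ i| <= M.
  have : cvgn (series (fun i => d i * t0 ^+ i)).
    by apply/cvg_ex; exists 0; apply: d0; rewrite gtr0_norm// t00.
  move=> /cvg_series_bounded/pinfty_ex_gt0[M _ dM]; exists M => i.
  exact: (dM i).
have M0 : 0 <= M by exact: le_trans (normr_ge0 _) (Mb 0%N).
suff small s : 0 < s <= 2^-1 -> `|d j * t0 ^+ j| <= 2 * M * s.
  have : `|d j * t0 ^+ j| <= 0.
    apply/ler_addgt0Pl => e e0; rewrite addr0.
    pose s := Num.min 2^-1 (e / (2 * M + 1)).
    have M1 : 0 < 2 * M + 1 by lra.
    have s0 : 0 < s by rewrite /s lt_min invr_gt0 ltr0n divr_gt0.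
    apply: (le_trans (small s _)); first by rewrite s0 /s ge_min lexx.
    have se : s <= e / (2 * M + 1) by rewrite /s ge_min lexx orbT.
    rewrite ler_pdivlMr// in se; nra.
  by rewrite normr_le0 mulf_eq0 expf_eq0 (gt_eqF t00) andbF orbF => /eqP.
move=> /andP[s0 s2].
have st : 0 < `|t0 * s| < r.
  rewrite gtr0_norm ?mulr_gt0//=; apply: le_lt_trans t0r.
  by rewrite ler_piMr// ?ltW//; lra.
have lim0 : `|pseries d (t0 * s) N| @[N --> \oo] --> `|0 : R|.
  by apply: cvg_norm; exact: d0.
rewrite normr0 in lim0.
have bound N : (j < N)%N ->
    `|d j * t0 ^+ j| * s ^+ j - 2 * M * s ^+ j.+1 <= `|pseries d (t0 * s) N|.
  move=> jN.
  have -> : pseries d (t0 * s) N = d j * t0 ^+ j * s ^+ j +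
      \sum_(j.+1 <= i < N) d i * t0 ^+ i * s ^+ i.
    rewrite /pseries /series/= (big_cat_nat (n := j))//=; last exact: ltnW.
    rewrite big_nat_cond big1 ?add0r; last by move=> i /andP[/IH -> _]; rewrite mul0r.
    by rewrite big_ltn//; congr (_ + _); rewrite ?exprMn ?mulrA//;
      apply: eq_bigr => i _; rewrite exprMn mulrA.
  rewrite lerBlDr; apply: (@le_trans _ _ (`|d j * t0 ^+ j * s ^+ j|)).
    by rewrite [leRHS]normrM (ger0_norm (exprn_ge0 _ (ltW s0))).
  set x := d j * _ * _; set y := \sum_(_ <= _ < _) _.
  have -> : x = x + y - y by rewrite addrK.
  apply: le_trans (ler_normB _ _) _; rewrite addrK lerD2l.
  apply: le_trans (ler_norm_sum _ _ _) _.
  have geo m : \sum_(j.+1 <= i < m) M * s ^+ i <= 2 * M * s ^+ j.+1.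
    suff : \sum_(j.+1 <= i < m) s ^+ i <= 2 * s ^+ j.+1.
      by rewrite -mulr_sumr; have := exprn_gt0 j.+1 s0; nra.
    have sj := exprn_gt0 j.+1 s0.
    have [mj|jm] := leqP m j.+1; first by rewrite big_geq//; lra.
    suff : (1 - s) * \sum_(j.+1 <= i < m) s ^+ i <= s ^+ j.+1 by nra.
    rewrite mulr_sumr (eq_bigr (fun i => s ^+ i - s ^+ i.+1)).
      rewrite (telescope_sumr_eq (fun i => - s ^+ i)) ?(ltnW jm)//; last first.
        by move=> k _; rewrite opprK addrC.
      by rewrite opprK addrC gerBl exprn_ge0// ltW.
    by move=> i _; rewrite exprS mulrBl mul1r.
  apply: le_trans (geo N); apply: ler_sum => i _.
  rewrite normrM (ger0_norm (exprn_ge0 _ (ltW s0))) ler_wpM2r ?exprn_ge0 ?(ltW s0)//.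
have : `|d j * t0 ^+ j| * s ^+ j - 2 * M * s ^+ j.+1 <= 0.
  apply: (cvgr_to_ge lim0); near=> N; apply: bound; near: N; exact: nbhs_infty_gt.
have sj := exprn_gt0 j s0.
by rewrite subr_le0 exprS mulrA ler_pM2r.
Unshelve. all: by end_near. Qed.

Definition bernoulli_egf : fps R := fun j => bernoulli R j / j`!%:R.

(** The formal inverse of (e^t - 1)/t has bounded coefficients, so it converges to
    t/(e^t - 1) near 0 and witnesses that the defining property of the Bernoulli
    numbers can be met; by uniqueness of power series expansions it is then their
    exponential generating function. *)
Lemma bernoulli_expquot : bernoulli_egf * fps_expquot R = 1.
Proof.
have E0 : fps_expquot R 0%N = 1 by rewrite /fps_expquot invr1.
have [b] := fps_inv_ex E0.
rewrite mulrC => bE.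
have b1 n := fps_expquot_inv_bounded n bE.
pose P (B : nat -> R) := \forall t \near (0 : R)^',
    pseries (fun j => B j / j`!%:R) t @ \oo --> t / (expR t - 1).
have PB : P (fun j => b j * j`!%:R).
  exists (8^-1 : R); first by rewrite /= invr_gt0.
  move=> t /=; rewrite sub0r normrN => t8 t0.
  rewrite (_ : (fun j => _) = b); last first.
    by apply/funext => j; rewrite mulfK// fact_neq0.
  by apply: cvg_bernoulli_series => //; rewrite normr_gt0 t0 ltW.
have [r /= r0 Pr] : P (bernoulli R) by exact: (getPex (ex_intro _ _ PB)).
suff -> : bernoulli_egf = b by [].
apply/funext => j; apply/eqP; rewrite -subr_eq0; apply/eqP.
pose r' := Num.min r 8^-1.
have r'0 : 0 < r' by rewrite /r' lt_min r0 invr_gt0 ltr0n.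
apply: (@pseries_eq0 (fun j => bernoulli_egf j - b j) r' r'0) => t /andP[t0].
rewrite /r' lt_min => /andP[tr t8].
have tn0 : t != 0 by rewrite -normr_gt0.
have c1 : pseries bernoulli_egf t @ \oo --> t / (expR t - 1).
  by apply: Pr => //=; rewrite sub0r normrN.
have c2 : pseries b t @ \oo --> t / (expR t - 1).
  by apply: cvg_bernoulli_series => //; rewrite t0 ltW.
have c3 : pseries bernoulli_egf t N - pseries b t N @[N --> \oo] --> (0 : R).
  by rewrite -[X in _ --> X](subrr (t / (expR t - 1))); exact: (cvgB c1 c2).
apply: cvg_trans c3; apply: near_eq_cvg.
apply: nearW => N; rewrite /pseries /series/= -sumrB.
by apply: eq_bigr => i _; rewrite mulrBl.
Qed.
End AnalyticBernoulli.

(** * The star generating function and its limit *)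

Section StarGenerating.
Variable R : realType.

(** The coefficients of an inverse are polynomials in those of the series. *)
Lemma cvg_fps_inv (f_ g_ : nat -> fps R) (f g : fps R) :
  (forall N, f_ N * g_ N = 1) -> (forall N, f_ N 0%N = 1) ->
  f * g = 1 -> f 0%N = 1 ->
  (forall j, f_ N j @[N --> \oo] --> f j) ->
  forall j, g_ N j @[N --> \oo] --> g j.
Proof.
move=> fg_ f0_ fg f0 cf; elim/ltn_ind => j IH.
have invE (a b : fps R) : a * b = 1 -> a 0%N = 1 ->
    b j = (j == 0%N)%:R - \sum_(i < j) a i.+1 * b (j - i.+1)%N.
  move=> /(congr1 (fun h : fps R => h j)) + a0.
  by rewrite fpsM fps1 big_ord_recl/= a0 mul1r subn0 => <-; rewrite addrK.
rewrite (invE _ _ fg f0).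
have -> : (fun N => g_ N j) = fun N => (j == 0%N)%:R -
    \sum_(i < j) f_ N i.+1 * g_ N (j - i.+1)%N.
  by apply/funext => N; exact: invE.
apply: cvgB; first exact: cvg_cst.
apply: cvg_big => [|i _]; first exact: add_continuous.
by apply: cvgM; [exact: cf|apply: IH; have := ltn_ord i; lia].
Qed.

Let w i : fps R := fpsC (invn R i).
Let X := fpsX R.

Definition star_word n := flatten (nseq n [:: 3; 1]%N).

(** The variable is X = x^2, so q = X^2 and the words sit in even degrees: in this
    variable 1 - q/k^4 splits into the real factors 1 - X/k^2 and 1 + X/k^2. *)
Definition star_gf N : fps R :=
  fun j => if odd j then 0 else star_sum R (star_word j./2) N.

Lemma star_word_gf N : star_gf N =
  fps_of_poly (zeta31_poly R N \Po 'X^2) *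
    ((\prod_(i < N) fps_geom (inv_sq R i)) *
     (\prod_(i < N) fps_geom (- inv_sq R i))).
Proof.
pose A := star_gf.
pose B N : fps R := fun j => if odd j then 0 else star_sum R (1%N :: star_word j./2) N.
rewrite -/(A N).
have A0 : A 0%N = 1.
  apply/funext => j; rewrite /A /star_gf fps1; case: j => [|[|j]] //=.
  by rewrite big_ord0 if_same.
have B0 : B 0%N = 0.
  by apply/funext => j; rewrite /B /= big_ord0 if_same.
have eB M : B M.+1 = B M + w M * A M.+1.
  apply/funext => j; rewrite fpsD fpsCM /A /star_gf /B; case: odd; rewrite ?mulr0 ?addr0//.
  by rewrite /= big_ord_recr/= expr1.
have eA M : A M.+1 = A M + X ^+ 2 * w M ^+ 3 * B M.+1.
  have -> : X ^+ 2 * w M ^+ 3 * B M.+1 = X * (X * (fpsC (invn R M ^+ 3) * B M.+1)).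
    by rewrite rmorphXn; ring.
  apply/funext => -[|[|j]]; rewrite fpsD !fpsXM ?addr0//.
  rewrite fpsCM /A /star_gf /B /= negbK.
  case: odd; rewrite ?mulr0 ?addr0//.
  by rewrite big_ord_recr/= /invn exprVn.
have := zeta31_star A0 B0 eB eA N.
have -> : (zeta31 (X ^+ 2) w N).1 = fps_of_poly (zeta31_poly R N \Po 'X^2).
  have c := zeta31_morph (@fps_of_poly R : {rmorphism {poly R} -> fps R})
    ('X ^+ 2) (polyC \o invn R) N.
  have := zeta31_morph (comp_poly 'X^2 : {rmorphism {poly R} -> {poly R}})
     'X (polyC \o invn R) N.
  rewrite /= comp_polyX => c2.
  have -> : zeta31_poly R N \Po 'X^2 = (zeta31 'X^2 (polyC \o invn R) N).1.
    rewrite /zeta31_poly.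
    transitivity (zeta31 'X^2 (comp_poly 'X^2 \o (polyC \o invn R)) N).1.
      by rewrite c2.
    by congr (zeta31 _ _ _).1; apply/funext => i /=; exact: comp_polyC.
  by have := congr1 fst c; rewrite /= rmorphXn.
move=> <-; rewrite -mulrA -!big_split/=.
rewrite big1 ?mulr1// => i _.
have g1 := fps_geomE (inv_sq R i); have g2 := fps_geomE (- inv_sq R i).
transitivity (((1 - fpsC (inv_sq R i) * fpsX R) * fps_geom (inv_sq R i)) *
   ((1 - fpsC (- inv_sq R i) * fpsX R) * fps_geom (- inv_sq R i))).
  rewrite rmorphN -invn_sq rmorphXn -/(w i) -/X; ring.
by rewrite g1 g2 mulr1.
Qed.

(** The value of zeta-star (2,...,2) with i entries, the coefficient of x^(2i) in
    pi x/sin (pi x). *)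
Definition star2 i : R :=
  pi ^+ (2 * i) * ((-1) ^+ i * ((2 - 2 ^+ (2 * i)) * bernoulli_egf R (2 * i))).

(** The product inverts prod (1 - s X/k^2), whose limit is sin (pi x)/(pi x) in
    x^2 = s X; for s = 1 and s = -1 these are the circular and the hyperbolic
    factor. *)
Lemma cvg_geom_prod (s : R) (u : nat -> R) j : (forall i, u i = s * inv_sq R i) ->
  (\prod_(i < N) fps_geom (u i)) j @[N --> \oo] --> s ^+ j * star2 j.
Proof.
move=> /funext ->.
pose l i : R := pi ^+ (2 * i) / (2 * i).+1`!%:R.
have f0 : fps_dilate (- s) (l : fps R) 0%N = 1.
  by rewrite /fps_dilate /l expr0 mul1r divr1.
pose f_ N : fps R := fps_of_poly (eprod (fun i => - s * inv_sq R i) N).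
pose g_ N : fps R := \prod_(i < N) fps_geom (s * inv_sq R i).
have fg_ N : f_ N * g_ N = 1.
  rewrite /f_ /g_ /eprod rmorph_prod -big_split big1//= => i _.
  rewrite -[RHS](fps_geomE (s * inv_sq R i)); congr (_ * _).
  by rewrite rmorphD rmorph1 rmorphM mulNr polyCN rmorphN mulNr.
have f0_ N : f_ N 0%N = 1 by exact: elsym0.
have fg : fps_dilate (- s) (l : fps R) * fps_dilate s (star2 : fps R) = 1.
  apply/funext => n; rewrite fpsM fps1.
  transitivity ((- s) ^+ n * pi ^+ (2 * n) * (n == 0%N)%:R).
    rewrite -(bernoulli_even_sinhc n (bernoulli_expquot R)) mulr_sumr.
    apply: eq_bigr => i _; have iN : (i <= n)%N by rewrite -ltnS.
    rewrite /fps_dilate /l /star2.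
    have -> : (- s) ^+ n = (- s) ^+ i * (s ^+ (n - i) * (-1) ^+ (n - i)).
      by rewrite -exprMn mulrN1 -exprD subnKC.
    have -> : pi ^+ (2 * n) = pi ^+ (2 * i) * pi ^+ (2 * (n - i)) :> R.
      by rewrite -exprD -mulnDr subnKC.
    ring.
  by case: n => [|n]; rewrite ?mulr0// !expr0 !mulr1.
have cf i : f_ N i @[N --> \oo] --> fps_dilate (- s) (l : fps R) i.
  have -> : (fun N => f_ N i) = (fun N => (- s) ^+ i * elsym (inv_sq R) N i).
    by apply/funext => N; rewrite -elsymZ.
  by apply: cvgMr; exact: cvg_elsym_inv_sq.
exact: (@cvg_fps_inv f_ g_ _ _ fg_ f0_ fg f0 cf).
Qed.

Lemma star_word_coef N n :
  star_sum R (star_word n) N = \sum_(i < n.+1) (zeta31_poly R N)`_i *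
    ((\prod_(i < N) fps_geom (inv_sq R i)) *
     (\prod_(i < N) fps_geom (- inv_sq R i))) (2 * (n - i))%N.
Proof.
set H := _ * _.
have := congr1 (fun h : fps R => h (2 * n)%N) (star_word_gf N).
rewrite -/H /star_gf mul2n odd_double doubleK -mul2n => ->.
rewrite fpsM (sum_even (F := fun i => fps_of_poly (zeta31_poly R N \Po 'X^2) i *
  H (2 * n - i)%N)) => [|i].
  by apply: eq_bigr => i _; rewrite -mulnBr fps_ofE -[X in _ \Po X]scale1r coef_comp_scaleX2 expr1n mul1r.
rewrite fps_ofE coef_comp_poly_Xn// dvdn2 /= mul2n odd_double mul0r//.
Qed.

Lemma cvg_star_sum n :
  star_sum R (star_word n) N @[N --> \oo] -->
  \sum_(i < n.+1) 2 * pi ^+ (4 * i) / (4 * i + 2)`!%:R *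
     \sum_(k < (2 * (n - i)).+1) star2 k *
        ((-1) ^+ (2 * (n - i) - k) * star2 (2 * (n - i) - k)%N).
Proof.
under eq_cvg do rewrite star_word_coef.
apply: cvg_big => [|i _]; first exact: add_continuous.
apply: cvgM; first exact: cvg_zeta31_poly.
under eq_cvg do rewrite fpsM.
apply: cvg_big => [|k _]; first exact: add_continuous.
apply: cvgM.
  rewrite -[star2 k]mul1r -(expr1n R k).
  by apply: (@cvg_geom_prod 1 (inv_sq R)) => l; rewrite mul1r.
by apply: (@cvg_geom_prod (-1) (fun l => - inv_sq R l)) => l; rewrite mulN1r.
Qed.

End StarGenerating.

(** * Rationality and the evaluation *)

Section Rationality.
Variable R : realType.
Definition rational (x : R) := exists q : rat, x = ratr q.
Lemma rationalD x y : rational x -> rational y -> rational (x + y).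
Proof. by move=> [p ->] [q ->]; exists (p + q); rewrite rmorphD. Qed.
Lemma rationalM x y : rational x -> rational y -> rational (x * y).
Proof. by move=> [p ->] [q ->]; exists (p * q); rewrite rmorphM. Qed.
Lemma rationalN x : rational x -> rational (- x).
Proof. by move=> [p ->]; exists (- p); rewrite rmorphN. Qed.
Lemma rationalV x : rational x -> rational x^-1.
Proof. by move=> [p ->]; exists p^-1; rewrite fmorphV. Qed.
Lemma rational_nat n : rational n%:R.
Proof. by exists n%:R; rewrite rmorph_nat. Qed.
Lemma rationalX x n : rational x -> rational (x ^+ n).
Proof. by move=> [p ->]; exists (p ^+ n); rewrite rmorphXn. Qed.
Lemma rational_sum (I : Type) (r : seq I) (P : pred I) (F : I -> R) :
  (forall i, P i -> rational (F i)) -> rational (\sum_(i <- r | P i) F i).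
Proof.
move=> rF; elim/big_ind : _ => //; last exact: rationalD.
exact: (rational_nat 0).
Qed.

(** The recurrence expressing that b(t) (e^t - 1)/t = 1 has rational
    coefficients. *)
Lemma rational_bernoulli j : rational (bernoulli R j).
Proof.
have H : rational (bernoulli_egf R j).
  elim/ltn_ind: j => j IH.
  have := congr1 (fun h : fps R => h j) (bernoulli_expquot R).
  rewrite mulrC fpsM fps1 big_ord_recl /fps_expquot/= subn0 invr1 mul1r.
  move/(canRL (addrK _)) => ->; apply: rationalD; first exact: rational_nat.
  apply/rationalN/rational_sum => i _; apply: rationalM; first exact/rationalV/rational_nat.
  by apply: IH; rewrite /bump/=; have := ltn_ord i; lia.
have -> : bernoulli R j = bernoulli_egf R j * j`!%:R.
  by rewrite /bernoulli_egf divfK// fact_neq0.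
by apply: rationalM => //; exact: rational_nat.
Qed.
End Rationality.

Theorem theoremB (R : realType) (n : nat) (hn : (0 < n)%N) :
  zeta_star R (flatten (nseq n [:: 3; 1]%N)) =
    ((\sum_(i < n.+1)
        (2 / (4 * i + 2)`!%:R *
         \sum_(n0 < (2 * (n - i)).+1)
           \sum_(n1 < (2 * (n - i)).+1 | (n0 + n1 == 2 * (n - i))%N)
             (-1) ^+ n1
             * ((2 ^+ (2 * n0) - 2) * bernoulli R (2 * n0) / (2 * n0)`!%:R)
             * ((2 ^+ (2 * n1) - 2) * bernoulli R (2 * n1) / (2 * n1)`!%:R)))
     * pi ^+ (4 * n))%:E
  /\ exists q : rat,
       zeta_star R (flatten (nseq n [:: 3; 1]%N)) =
         (ratr q * pi ^+ (4 * n))%:E.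
Proof.
set S := \sum_(i < n.+1) _.
have zE : zeta_star R (flatten (nseq n [:: 3; 1]%N)) = (S * pi ^+ (4 * n))%:E.
  have := @cvg_star_sum R n; rewrite /star_word.
  case: n hn @S => // n _ S /zeta_star_lim ->.
  congr EFin; rewrite mulr_suml; apply: eq_bigr => i _.
  have iN : (i <= n.+1)%N by rewrite -ltnS.
  set m := (2 * (n.+1 - i))%N.
  have -> : (4 * n.+1 = 4 * i + 2 * m)%N by rewrite /m; lia.
  rewrite exprD; set F := _`!%:R.
  set S1 := (\sum_(k < m.+1) _ in LHS); set S2 := (\sum_(n0 < m.+1) _ in RHS).
  suff -> : S1 = S2 * pi ^+ (2 * m) by ring.
  rewrite /S1 /S2 mulr_suml; apply: eq_bigr => k _.
  have km : (k <= m)%N by rewrite -ltnS.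
  have mk : (m - k < m.+1)%N by rewrite ltnS leq_subr.
  rewrite (big_pred1 (Ordinal mk)) => [|j /=]; last first.
    by rewrite -val_eqE/=; apply/eqP/eqP; lia.
  rewrite /star2 /bernoulli_egf/=.
  have s2 : (-1) ^+ (m - k) * (-1) ^+ k = 1 :> R.
    by rewrite -exprD subnK// /m mul2n -signr_odd odd_double.
  have -> : pi ^+ (2 * m) = pi ^+ (2 * k) * pi ^+ (2 * (m - k)) :> R.
    by rewrite -exprD; congr (_ ^+ _); lia.
  set e := (-1) ^+ (m - k) in s2 *; set e' := (-1) ^+ k in s2 *.
  set a := bernoulli R _; set b := bernoulli R _.
  set x := _`!%:R; set y := _`!%:R.
  transitivity (e * e' * (e * (pi ^+ (2 * k) * pi ^+ (2 * (m - k)) *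
    ((2 ^+ (2 * k) - 2) * a / x) * ((2 ^+ (2 * (m - k)) - 2) * b / y)))).
    ring.
  rewrite s2; ring.
split=> //; rewrite zE.
suff [q ->] : rational S by exists q.
have r2 : rational (2 : R) by exact: rational_nat.
have beta k : rational ((2 ^+ (2 * k) - 2) * bernoulli R (2 * k) / (2 * k)`!%:R).
  apply: rationalM; last exact/rationalV/rational_nat.
  by apply: rationalM; [apply: rationalD; [exact: rationalX|exact: rationalN]|exact: rational_bernoulli].
apply: rational_sum => i _; apply: rationalM; first by apply: rationalM => //; exact/rationalV/rational_nat.
apply: rational_sum => n0 _; apply: rational_sum => n1 _.
apply: rationalM => //; apply: rationalM => //; apply/rationalX/rationalN; exact: (rational_nat R 1).
Qed.
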